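(* For every $L\ge 0$ there exists a positive number $C(L)$, depending only on $L$, such that the following holds. Let $n\ge 2$ and let $P(z)=\sum_{k=0}^n\lambda_k z^k$ be a random polynomial whose coefficients $\lambda_0,\lambda_1,\dots,\lambda_n$ are independent identically distributed complex-valued random variables satisfying $\mathbb P\{\lambda_0=0\}=\mathbb P\{\lambda_n=0\}=0$. Then \[ \sup\bigl\{\mathbb E[N(\Gamma;P)]\colon\Gamma\text{ is an }L\text{-Lipschitz curve}\bigr\}\le C(L)\,\log^4 n . \]
   Context: $\Gamma$ denotes a curve in $\mathbb C$ given in polar coordinates by $\Gamma=\{z=re^{\mathrm i\theta}\colon\theta=\theta(r),\ 0\le r<\infty\}$, where $\theta$ is a real-valued function. It is called $L$-Lipschitz if $|\theta(r_1)-\theta(r_2)|\le L\,\bigl|\log\frac{r_1}{r_2}\bigr|$ for all $r_1,r_2>0$. $N(\Gamma;P)$ is the number of zeroes of $P$ on $\Gamma$, counted with multiplicities. $\mathbb E$ denotes expectation. *)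

(* Defs.v *)
From HB Require Import structures.
From mathcomp Require Import all_boot all_order all_algebra.
From mathcomp Require Import complex.
From mathcomp Require Import all_classical all_reals all_analysis.

Set Implicit Arguments.
Unset Strict Implicit.
Unset Printing Implicit Defensive.
Import Order.TTheory GRing.Theory Num.Theory.
Import numFieldNormedType.Exports.

Local Open Scope classical_set_scope.
Local Open Scope ring_scope.
Local Open Scope complex_scope.

Definition complex_pair (R : realType) (z : R[i]) : R * R :=
  (complex.Re z, complex.Im z).

HB.instance Definition _ (R : realType) := isPointed.Build R[i] 0.

(* The Borel sigma-algebra of the complex plane: that of [R * R], transported
   along [x +i* y |-> (x, y)]. *)
HB.instance Definition _ (R : realType) :=
  @isMeasurable.Build (preimage_display (@complex_pair R)) R[i]
    (g_sigma_algebra_preimage (@complex_pair R))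
    (@measurable0 _ (g_sigma_algebra_preimageType (@complex_pair R)))
    (@measurableC _ (g_sigma_algebra_preimageType (@complex_pair R)))
    (@bigcupT_measurable _ (g_sigma_algebra_preimageType (@complex_pair R))).

Definition independent_family d d' (T : measurableType d)
    (T' : measurableType d') (R : realType) (P : probability T R) (I : finType)
    (X : I -> {RV P >-> T'}) : Prop :=
  forall (J : {set I}) (A : I -> set T'),
    (forall i, i \in J -> measurable (A i)) ->
    P (\bigcap_(i in [set` J]) (X i @^-1` A i)) =
    (\prod_(i in J) P (X i @^-1` A i))%E.

Definition identically_distributed d d' (T : measurableType d)
    (T' : measurableType d') (R : realType) (P : probability T R) (I : Type)
    (X : I -> {RV P >-> T'}) : Prop :=
  forall (i j : I) (A : set T'), measurable A ->
    distribution P (X i) A = distribution P (X j) A.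

Definition polar_curve (R : realType) (theta : R -> R) : set R[i] :=
  [set z | exists2 r : R, 0 <= r &
    z = (r * cos (theta r)) +i* (r * sin (theta r))].

(* [theta] is total, but its values at negative radii are irrelevant. *)
Definition lipschitz_curve (R : realType) (L : R) (Gamma : set R[i]) : Prop :=
  exists2 theta : R -> R,
    forall r1 r2 : R, 0 < r1 -> 0 < r2 ->
      `|theta r1 - theta r2| <= L * `|ln (r1 / r2)|
  & Gamma = polar_curve theta.

(* The zero polynomial is treated separately because [mup z 0 = 0]. *)
Definition zeros_on (R : realType) (Gamma : set R[i]) (p : {poly R[i]})
    : \bar R :=
  if p == 0 then +oo%E else \esum_(z in Gamma) ((mup z p)%:R : R)%:E.

Definition random_poly d (T : measurableType d) (R : realType)
    (P : probability T R) (n : nat) (lambda : 'I_n.+1 -> {RV P >-> R[i]})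
    (w : T) : {poly R[i]} :=
  \sum_(k < n.+1) lambda k w *: 'X^k.

(* Main.v *)
(* Let x_j be the coefficients of p, and M = max_j |x_j| r^j.  At log-radius s, the
   maximal term nu is a record of the sequence |x_j| (read from the left if s <= 0,
   from the right if s >= 0), and every other term is smaller by a factor
   exp (- |j - nu| t), where t is the distance from s to the nearest breakpoint b of
   the Newton polygon.  Hence there are no zeros when t > 2, and the rest of the curve
   is covered, for each record, by O(log n) arcs, each short compared with its
   distance to b (or with 1/n).
   On an annulus adapted to such an arc, dividing the Laurent polynomial p / z^nu
   by its zeros (a form of Jensen's formula) bounds their number by the logarithm
   of n^O(1) M / Y, with Y the sum of |p| over n + 2 close points of the arc.

   Lower bound for Y.  A polynomial with m nonzero coefficients is at least
   n^(- O(m)) times its largest term on such points (Turan's lemma, in its weak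
   Vandermonde form).  Consider the differences of neighbouring coefficients.
   If O(log n) of them, in disjoint positions, are large compared with Y, then
   swapping the two coefficients of any of these pairs preserves the law, while by
   Turan's lemma at most one of the 2^(8 log n) configurations has such a small Y;
   so this has probability at most 2^(- 8 log n), which absorbs a union bound over
   all cells.  Otherwise (1 - z) p has only O(log n) large coefficients, and Turan's
   lemma gives M <= exp (O(log^2 n)) Y.

   So outside a rare event each arc carries O(log^2 n) zeros, and the curve carries
   O(log^3 n) times the number of records; by exchangeability the expected number of
   records is at most twice a harmonic sum, that is O(log n). *)
Require Import Defs.
From HB Require Import structures.
From mathcomp Require Import all_boot all_order all_algebra.
From mathcomp Require Import complex.
From mathcomp Require Import all_classical all_reals all_analysis.
From mathcomp Require Import perm measurable_realfun ring lra zify.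

Set Implicit Arguments.
Unset Strict Implicit.
Unset Printing Implicit Defensive.
Import Order.TTheory GRing.Theory Num.Theory.
Import numFieldNormedType.Exports.
Import ComplexField.Normc.

Local Open Scope ring_scope.
Local Open Scope complex_scope.

(** * The complex modulus *)

Section ComplexModulus.
Variable R : rcfType.
Implicit Types x y z : R[i].

Lemma normc_zero : normc (0 : R[i]) = 0.
Proof. exact: normc0. Qed.

Lemma normc_one : normc (1 : R[i]) = 1.
Proof. exact: normc1. Qed.

Lemma normc_ge0 x : 0 <= normc x.
Proof. by case: x => a b; exact: sqrtr_ge0. Qed.

Lemma normc_eq0 x : (normc x == 0) = (x == 0).
Proof. by apply/eqP/eqP => [/eq0_normc//|->]; exact: normc_zero. Qed.

Lemma normc_gt0 x : (0 < normc x) = (x != 0).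
Proof. by rewrite lt_def normc_eq0 normc_ge0 andbT. Qed.

Lemma ler_normcD x y : normc (x + y) <= normc x + normc y.
Proof. exact: le_normcD. Qed.

Lemma normc_opp x : normc (- x) = normc x.
Proof. exact: normcN. Qed.

Lemma normc_distC x y : normc (x - y) = normc (y - x).
Proof. by rewrite -normc_opp opprB. Qed.

Lemma ler_normcB x y : normc (x - y) <= normc x + normc y.
Proof. by rewrite -(normc_opp y) ler_normcD. Qed.

Lemma ler_normc_sum (I : Type) (r : seq I) (P : pred I) (F : I -> R[i]) :
  normc (\sum_(i <- r | P i) F i) <= \sum_(i <- r | P i) normc (F i).
Proof.
elim/big_ind2: _ => [|x1 x2 y1 y2 h1 h2|//]; first by rewrite normc_zero.
by rewrite (le_trans (ler_normcD _ _))// lerD.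
Qed.

Lemma normcX x n : normc (x ^+ n) = normc x ^+ n.
Proof. by elim: n => [|n IH]; rewrite ?expr0 ?normc_one// !exprS normcM IH. Qed.

Lemma normc_prod (I : Type) (r : seq I) (P : pred I) (F : I -> R[i]) :
  normc (\prod_(i <- r | P i) F i) = \prod_(i <- r | P i) normc (F i).
Proof. exact: (big_morph (@normc R) (@normcM R) normc_one). Qed.

Lemma ler_normc_ReIm (a b : R) : normc (a +i* b) <= `|a| + `|b|.
Proof.
rewrite -[leRHS](ger0_norm (addr_ge0 (normr_ge0 _) (normr_ge0 _))) -sqrtr_sqr.
rewrite ler_wsqrtr// -(real_normK (num_real a)) -(real_normK (num_real b)).
by rewrite sqrrD lerD2r lerDl mulrn_wge0// mulr_ge0.
Qed.

End ComplexModulus.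

(** * Zeros of Laurent polynomials in an annulus *)

Section LaurentDivision.
Variable R : rcfType.
Implicit Types (p q : {poly R[i]}) (zeta : R[i]).

(** Together with [lower_norm], this is the coefficient norm of the Laurent polynomial [p / 'X^nu]
    on an annulus: nonnegative powers are weighted at the outer radius [Rp], negative ones at the
    inner radius [Rm]. *)
Definition upper_norm (Rp : R) (nu N : nat) p : R :=
  \sum_(nu <= i < N) normc p`_i * Rp ^+ (i - nu).

Definition lower_norm (Rm : R) (nu : nat) p : R :=
  \sum_(0 <= i < nu) normc p`_i * Rm ^- (nu - i).

Lemma upper_norm_ge0 (Rp : R) nu N p : 0 <= Rp -> 0 <= upper_norm Rp nu N p.
Proof.
move=> Rp0; apply: sumr_ge0 => i _.
by rewrite mulr_ge0 ?normc_ge0 ?exprn_ge0.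
Qed.

Lemma lower_norm_ge0 (Rm : R) nu p : 0 <= Rm -> 0 <= lower_norm Rm nu p.
Proof.
move=> Rp0; apply: sumr_ge0 => i _.
by rewrite mulr_ge0 ?normc_ge0// invr_ge0 exprn_ge0.
Qed.

Lemma coefXsubCM zeta q i :
  (('X - zeta%:P) * q)`_i = (if i is i'.+1 then q`_i' else 0) - zeta * q`_i.
Proof. by rewrite mulrBl coefB coefXM coefCM; case: i. Qed.

(** From [q_i = p_(i+1) + zeta q_(i+1)], weighting by [Rp ^+ (i.+1 - nu)] and summing gives
    [Rp |q| <= |p| + |zeta| |q|] in this norm. The size bound ensures that the shifted sums pick up
    nothing at index [N]. *)
Lemma upper_norm_div (Rp : R) (nu N : nat) zeta q :
  0 <= Rp -> (nu <= N)%N -> (size (('X - zeta%:P) * q)%R <= N)%N ->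
  (Rp - normc zeta) * upper_norm Rp nu N q
    <= upper_norm Rp nu N (('X - zeta%:P) * q).
Proof.
move=> Rp0 nuN; set p := _ * q => szp.
have [->|q0] := eqVneq q 0.
  rewrite [X in _ * X]big1 ?mulr0 ?upper_norm_ge0// => i _.
  by rewrite coef0 normc_zero mul0r.
have szq : (size q < N)%N.
  by move: szp; rewrite /p mulrC size_Mmonic ?monicXsubC// size_XsubC addn2.
have shift (f : {poly R[i]}) : f`_N = 0 ->
    \sum_(nu <= i < N) normc f`_i.+1 * Rp ^+ (i.+1 - nu) <= upper_norm Rp nu N f.
  move=> fN.
  have -> : \sum_(nu <= i < N) normc f`_i.+1 * Rp ^+ (i.+1 - nu)
     = \sum_(nu.+1 <= i < N.+1) normc f`_i * Rp ^+ (i - nu).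
    by rewrite big_add1.
  have : upper_norm Rp nu N.+1 f = upper_norm Rp nu N f.
    by rewrite /upper_norm big_nat_recr//= fN normc_zero mul0r addr0.
  move=> <-; rewrite /upper_norm [leRHS]big_ltn ?ltnS//.
  by rewrite lerDr mulr_ge0 ?normc_ge0 ?exprn_ge0.
rewrite mulrBl lerBlDr.
have pN : p`_N = 0 by rewrite nth_default.
have qN : q`_N = 0 by rewrite nth_default// ltnW.
apply: (@le_trans _ _ (\sum_(nu <= i < N) (normc p`_i.+1 * Rp ^+ (i.+1 - nu)
    + normc zeta * (normc q`_i.+1 * Rp ^+ (i.+1 - nu))))).
  rewrite /upper_norm mulr_sumr; apply: ler_sum_nat => i /andP[nui _].
  rewrite subSn// mulrCA -exprS mulrA -mulrDl.
  rewrite ler_wpM2r ?exprn_ge0//.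
  have -> : q`_i = p`_i.+1 + zeta * q`_i.+1 by rewrite /p coefXsubCM subrK.
  by rewrite (le_trans (ler_normcD _ _))// normcM.
rewrite big_split/= -mulr_sumr lerD// ?shift//.
by rewrite ler_wpM2l ?normc_ge0// shift.
Qed.

(** The recurrence is now read in the other direction, [zeta q_i = q_(i-1) - p_i]; the shift by one
    index costs a factor [Rm]. *)
Lemma lower_norm_div (Rm : R) (nu : nat) zeta q : 0 < Rm ->
  (normc zeta - Rm) * lower_norm Rm nu q
    <= lower_norm Rm nu (('X - zeta%:P) * q).
Proof.
move=> Rm0; set p := _ * q.
have w0 k : 0 <= Rm ^- k by rewrite invr_ge0 exprn_ge0// ltW.
rewrite mulrBl lerBlDr.
apply: (@le_trans _ _ (\sum_(0 <= i < nu) (normc p`_i * Rm ^- (nu - i)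
    + normc (if i is i'.+1 then q`_i' else 0) * Rm ^- (nu - i)))).
  rewrite /lower_norm mulr_sumr; apply: ler_sum_nat => i _.
  rewrite mulrA -mulrDl ler_wpM2r// -normcM.
  have -> : zeta * q`_i = (if i is i'.+1 then q`_i' else 0) - p`_i.
    by rewrite /p coefXsubCM subKr.
  by rewrite (le_trans (ler_normcB _ _))// addrC.
rewrite big_split/= lerD2l.
case: nu => [|nu]; first by rewrite /lower_norm !big_geq// mulr0.
rewrite /lower_norm big_ltn// normc_zero mul0r add0r big_add1/= mulr_sumr.
rewrite [leRHS]big_nat_recr//= -[leLHS]addr0 lerD//.
  apply: ler_sum_nat => i /andP[_ inu].
  rewrite subSS subSn; last exact: ltnW.
  by rewrite [leRHS]mulrCA exprS invfM mulVKf// gt_eqF.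
by rewrite !mulr_ge0 ?normc_ge0// ltW.
Qed.

(* Dividing the Laurent polynomial [p / 'X^nu] by [z - zeta] divides its
   coefficient norm on the annulus [Rm < |z| < Rp] by at least the distance
   from [zeta] to the boundary. *)
Lemma annulus_zeros (Rp Rm kappa : R) (nu N : nat) (zs : seq R[i]) p q (z : R[i]) :
  0 < Rm -> 0 <= kappa -> (nu <= N)%N ->
  p = \prod_(zeta <- zs) ('X - zeta%:P) * q -> (size p <= N)%N ->
  (forall zeta, zeta \in zs -> kappa <= Rp - normc zeta) ->
  (forall zeta, zeta \in zs -> kappa <= normc zeta - Rm) ->
  (forall zeta, zeta \in zs -> 2 * normc (z - zeta) <= kappa) ->
  Rm <= normc z <= Rp ->
  2 ^+ size zs * normc p.[z]
    <= normc z ^+ nu * (upper_norm Rp nu N p + lower_norm Rm nu p).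
Proof.
move=> Rm0 kappa0 nuN -> {p} szp kp km kz /andP[mz zp]; set p := _ * q in szp *.
have z0 : 0 < normc z by exact: lt_le_trans mz.
have Rp0 : 0 <= Rp by rewrite ltW// (lt_le_trans z0).
have qz : (size q <= N)%N -> normc q.[z]
    <= normc z ^+ nu * (upper_norm Rp nu N q + lower_norm Rm nu q).
  move=> szq; rewrite (horner_coef_wide _ szq).
  rewrite (le_trans (ler_normc_sum _ _ _))//.
  rewrite -(big_mkord xpredT (fun i => normc (q`_i * z ^+ i))).
  rewrite (@big_cat_nat _ _ _ nu)//= mulrDr addrC !mulr_sumr lerD//.
    apply: ler_sum_nat => i /andP[nui _].
    rewrite normcM normcX mulrCA ler_wpM2l ?normc_ge0//.
    rewrite -[in leLHS](subnKC nui) exprD.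
    by rewrite ler_wpM2l ?exprn_ge0 ?normc_ge0 ?lerXn2r ?nnegrE ?normc_ge0.
  apply: ler_sum_nat => i /andP[_ inu].
  rewrite normcM normcX mulrCA ler_wpM2l ?normc_ge0//.
  rewrite -[in X in _ <= X * _](subnKC (ltnW inu)) exprD -mulrA.
  apply: ler_peMr; first by rewrite exprn_ge0 ?normc_ge0.
  rewrite ler_pdivlMr ?exprn_gt0// mul1r.
  by apply: lerXn2r => //; rewrite nnegrE ?normc_ge0// ltW.
(* Each removed zero divides the norm by at least [kappa], while its linear factor at [z] is at most
   [kappa / 2]. The quotient of the two is the factor 2 gained per zero. *)
suff : kappa ^+ size zs * (upper_norm Rp nu N q + lower_norm Rm nu q)
    <= upper_norm Rp nu N p + lower_norm Rm nu p /\
    2 ^+ size zs * normc p.[z] <= kappa ^+ size zs * normc q.[z] /\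
    (size q <= N)%N.
  move=> [h1 [h2 szq]]; rewrite (le_trans h2)//.
  apply: (le_trans (ler_wpM2l (exprn_ge0 _ kappa0) (qz szq))).
  by rewrite mulrCA ler_wpM2l ?exprn_ge0 ?normc_ge0.
clear qz; rewrite /p in szp *; clear p.
elim: zs szp kp km kz => [|a zs IH] /=.
  by rewrite big_nil !mul1r.
rewrite big_cons -mulrA => szp kp km kz.
set p1 := \prod_(j <- zs) _ * q in IH szp *.
have szp1 : (size p1 <= N)%N.
  have [->|p10] := eqVneq p1 0; first by rewrite size_poly0.
  move: szp; rewrite mulrC size_Mmonic ?monicXsubC// size_XsubC addn2 /=.
  exact: ltnW.
have {IH} [||||h1 [h2 h3]] := IH; do ?[by []].
- by move=> x xzs; apply: kp; rewrite inE xzs orbT.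
- by move=> x xzs; apply: km; rewrite inE xzs orbT.
- by move=> x xzs; apply: kz; rewrite inE xzs orbT.
split; last split => //.
- rewrite exprS -mulrA; apply: (le_trans (ler_wpM2l kappa0 h1)).
  rewrite mulrDr lerD//.
    apply: le_trans (upper_norm_div Rp0 nuN szp).
    by rewrite ler_wpM2r ?upper_norm_ge0// kp// mem_head.
  apply: le_trans (lower_norm_div _ _ _ Rm0).
  by rewrite ler_wpM2r ?lower_norm_ge0// ?km ?mem_head// ltW.
- rewrite hornerM hornerXsubC normcM !exprS mulrACA -[leRHS]mulrA.
  by rewrite ler_pM ?mulr_ge0 ?normc_ge0 ?exprn_ge0 ?kz ?mem_head.
Qed.

End LaurentDivision.

(** * A Turan-type inequality *)

Section Turan.
Variable R : rcfType.
Implicit Types (p q : {poly R[i]}).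

(** A factor ['X - z] with [z] on the unit circle at most doubles the sum of the moduli of the
    coefficients. *)
Lemma sum_normc_coef_prod_XsubC (zs : seq R[i]) N :
  (forall z, z \in zs -> normc z = 1) ->
  \sum_(i < N) normc (\prod_(z <- zs) ('X - z%:P))`_i <= 2 ^+ size zs.
Proof.
elim: zs => [|z zs IH] zs1.
  rewrite big_nil expr0; case: N => [|N]; first by rewrite big_ord0.
  rewrite big_ord_recl coef1 normc_one big1 ?addr0// => i _.
  by rewrite coef1 normc_zero.
rewrite big_cons; set q := \prod_(_ <- zs) _ in IH *.
have {}IH : \sum_(i < N) normc q`_i <= 2 ^+ size zs.
  by apply: IH => x xs; rewrite zs1// inE xs orbT.
apply: (@le_trans _ _ (\sum_(i < N)
    (normc (if (i : nat) is i'.+1 then q`_i' else 0) + normc q`_i))).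
  apply: ler_sum => i _; rewrite coefXsubCM (le_trans (ler_normcB _ _))//.
  by rewrite normcM (zs1 z) ?mem_head// mul1r.
rewrite big_split/= exprS mulr_natl mulr2n lerD//; apply: le_trans IH.
case: N => [|N]; first by rewrite !big_ord0.
rewrite big_ord_recl normc_zero add0r [leRHS]big_ord_recr/=.
by rewrite lerDl normc_ge0.
Qed.

(* Pairing the data with the polynomial vanishing at all the other nodes
   isolates the coefficient of one node. *)
Lemma coef_le_max_powersum (N m : nat) (c zeta : 'I_N -> R[i]) (eta Y : R) :
  0 < eta -> eta <= 2 -> 0 <= Y ->
  (forall i, normc (zeta i) = 1) ->
  (forall i j, i != j -> eta <= normc (zeta i - zeta j)) ->
  (#|[set i | c i != 0%R]| <= m)%N ->
  (forall l, (l < N)%N -> normc (\sum_(i < N) c i * zeta i ^+ l) <= Y) ->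
  forall j, normc (c j) <= (2 / eta) ^+ m * Y.
Proof.
move=> eta0 eta2 Y0 z1 sep Em hY j.
have e1 : 1 <= 2 / eta by rewrite ler_pdivlMr// mul1r.
have [cj0|cj0] := eqVneq (c j) 0.
  by rewrite cj0 normc_zero mulr_ge0// exprn_ge0// (le_trans ler01).
pose E := [set i | c i != 0] :\ j.
have jE : j \in [set i | c i != 0] by rewrite inE.
have cE : (#|E|.+1 <= m)%N by move: Em; rewrite (cardsD1 j) jE.
have cEN : (#|E|.+1 <= N)%N.
  rewrite -[X in (_ <= X)%N]card_ord.
  rewrite (leq_trans _ (max_card [set i | c i != 0]))//.
  by rewrite (cardsD1 j [set i | c i != 0]) jE.
pose zs := [seq zeta i | i <- enum E].
pose q := \prod_(z <- zs) ('X - z%:P).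
have szs : size zs = #|E| by rewrite size_map cardE.
have zs1 z : z \in zs -> normc z = 1 by move=> /mapP[i _ ->].
have szq : (size q <= N)%N.
  by rewrite size_prod_XsubC szs.
have qj : eta ^+ #|E| <= normc q.[zeta j].
  rewrite /q horner_prod normc_prod big_map big_enum/= -prodr_const.
  apply: ler_prod => i; rewrite !inE => /andP[ij _].
  by rewrite ltW//= !hornerE sep// eq_sym.
have qE i : i \in E -> q.[zeta i] = 0.
  move=> iE; apply/eqP; rewrite -/(root q (zeta i)) root_prod_XsubC.
  by apply/mapP; exists i; rewrite ?mem_enum.
(* Summing [c i * q.[zeta i]] over all nodes leaves only [i = j], since [q] vanishes at every other
   node with nonzero data; expanding [q] then turns this sum into a combination of the power
   sums. *)
have key : c j * q.[zeta j]
    = \sum_(l < N) q`_l * (\sum_(i < N) c i * zeta i ^+ l).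
  transitivity (\sum_(i < N) c i * q.[zeta i]).
    rewrite (bigD1 j)//= big1 ?addr0// => i ij.
    have [->|ci] := eqVneq (c i) 0; first by rewrite mul0r.
    by rewrite qE ?mulr0// !inE ij ci.
  under eq_bigr => i _ do rewrite (horner_coef_wide _ szq) mulr_sumr.
  rewrite exchange_big/=; apply: eq_bigr => l _; rewrite mulr_sumr.
  by apply: eq_bigr => i _; rewrite mulrCA.
have h : normc (c j) * eta ^+ #|E| <= 2 ^+ #|E| * Y.
  apply: (@le_trans _ _ (normc (c j * q.[zeta j]))).
    by rewrite normcM ler_wpM2l ?normc_ge0.
  rewrite key (le_trans (ler_normc_sum _ _ _))//.
  apply: (@le_trans _ _ (\sum_(l < N) normc q`_l * Y)).
    by apply: ler_sum => l _; rewrite normcM ler_wpM2l ?normc_ge0 ?hY.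
  by rewrite -mulr_suml ler_wpM2r// -szs sum_normc_coef_prod_XsubC.
have h' : normc (c j) <= (2 / eta) ^+ #|E| * Y.
  by rewrite expr_div_n mulrAC ler_pdivlMr ?exprn_gt0.
rewrite (le_trans h')// ler_wpM2r// ler_weXn2l// ltnW//.
Qed.

(** The values [p.[w * v ^+ l]] are the power sums of the nodes [v ^+ i] with data [p_i w^i]. As [v]
    has modulus 1, the distance between two nodes depends only on the difference of their
    exponents. *)
Lemma coef_le_max_arc (N m : nat) p (w v : R[i]) (eta Y : R) :
  0 < eta -> eta <= 2 -> 0 <= Y ->
  normc v = 1 ->
  (forall d, (0 < d < N)%N -> eta <= normc (v ^+ d - 1)) ->
  (size p <= N)%N ->
  (#|[set i : 'I_N | (p`_i != 0)%R]| <= m)%N ->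
  (forall l, (l < N)%N -> normc p.[w * v ^+ l] <= Y) ->
  forall j, normc p`_j * normc w ^+ j <= (2 / eta) ^+ m * Y.
Proof.
move=> eta0 eta2 Y0 v1 sep szp Em hY j.
have [jN|jN] := ltnP j N; last first.
  rewrite nth_default ?(leq_trans szp)// normc_zero mul0r mulr_ge0//.
  by rewrite exprn_ge0// divr_ge0// ltW.
rewrite -normcX -normcM.
apply: (@coef_le_max_powersum N m (fun i => p`_i * w ^+ i) (fun i => v ^+ i)
  eta Y _ _ _ _ _ _ _ (Ordinal jN)) => //.
- by move=> i; rewrite normcX v1 expr1n.
- have sepl (i k : 'I_N) : (i < k)%N -> eta <= normc (v ^+ i - v ^+ k).
    move=> ik; rewrite -(subnKC (ltnW ik)) exprD -[X in X - _]mulr1 -mulrBr.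
    rewrite normcM normcX v1 expr1n mul1r normc_distC sep//.
    by rewrite subn_gt0 ik (leq_ltn_trans (leq_subr _ _)).
  move=> i k; rewrite neq_ltn => /orP[|] ik; first exact: sepl.
  by rewrite normc_distC sepl.
- apply: leq_trans Em; apply: subset_leq_card; apply/fintype.subsetP => i.
  by rewrite !inE; apply: contraNneq => ->; rewrite mul0r.
- move=> l lN; apply: le_trans (hY l lN).
  rewrite (horner_coef_wide _ szp) le_eqVlt; apply/orP; left; apply/eqP.
  by congr normc; apply: eq_bigr => i _; rewrite exprMn mulrA exprAC.
Qed.

End Turan.

(** * Separation of points on the unit circle *)

Section UnitCircle.
Variable R : realType.
Implicit Types a b h x : R.

Lemma ler_dist_sin a b : `|sin a - sin b| <= `|a - b|.
Proof.
wlog ab : a b / b <= a.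
  by move=> H; have [/H//|/ltW/H] := leP b a; rewrite distrC [leRHS]distrC.
have [|c _ ->] := @MVT_segment R sin cos b a ab (fun x _ => is_derive_sin x).
  exact/continuous_subspaceT/continuous_sin.
by rewrite normrM ler_piMl// cos_max.
Qed.

Lemma ler_dist_cos a b : `|cos a - cos b| <= `|a - b|.
Proof.
wlog ab : a b / b <= a.
  by move=> H; have [/H//|/ltW/H] := leP b a; rewrite distrC [leRHS]distrC.
have [|c _ ->] := @MVT_segment R cos (- sin)%R b a ab (fun x _ => is_derive_cos x).
  exact/continuous_subspaceT/continuous_cos.
by rewrite normrM ler_piMl// normrN sin_max.
Qed.

(** Mean value theorem, with [cos c = 1 - 2 sin^2 (c / 2) >= 1 / 2] because [sin (c / 2)] is at most
    [1 / 2] in modulus. *)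
Lemma half_le_sin x : 0 <= x <= 1 -> x / 2 <= sin x.
Proof.
move=> /andP[x0 x1].
have [|c /[!in_itv]/= /andP[c0 cx]] :=
    @MVT_segment R sin cos 0 x x0 (fun x _ => is_derive_sin x).
  exact/continuous_subspaceT/continuous_sin.
rewrite sin0 !subr0 => ->; rewrite mulrC ler_wpM2r//.
have := ler_dist_sin (c / 2) 0; rewrite sin0 !subr0.
rewrite (ger0_norm (_ : 0 <= c / 2)) ?divr_ge0// => h.
rewrite (_ : c = (c / 2) *+ 2) ?cos_mulr2n ?cos2sin2; last by field.
have : `|sin (c / 2)| ^+ 2 <= (1 / 2) ^+ 2 by rewrite lerXn2r ?nnegrE//; lra.
by rewrite real_normK ?num_real// => ?; lra.
Qed.

Definition expi a : R[i] := cos a +i* sin a.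

Lemma normc_expi a : normc (expi a) = 1.
Proof. by rewrite /expi /= cos2Dsin2 sqrtr1. Qed.

Lemma expiD a b : expi (a + b) = expi a * expi b.
Proof.
rewrite /expi cosD sinD; apply/eqP; rewrite eq_complex /=.
by rewrite eqxx/= addrC mulrC [X in _ + X]mulrC.
Qed.

Lemma expi_expn a n : expi a ^+ n = expi (n%:R * a).
Proof.
elim: n => [|n IH]; first by rewrite mul0r expr0 /expi cos0 sin0.
by rewrite exprS IH -expiD -nat1r mulrDl mul1r.
Qed.

Lemma ler_dist_expi a b : normc (expi a - expi b) <= 2 * `|a - b|.
Proof.
apply: (le_trans (ler_normc_ReIm _ _)).
by rewrite mulr_natl mulr2n lerD ?ler_dist_cos ?ler_dist_sin.
Qed.

(** The imaginary part alone suffices: it is the sine of [d h], and [d h] lies in [[h, 1]]. *)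
Lemma expi_separated h (N d : nat) : 0 < h -> N%:R * h <= 1 ->
  (0 < d < N)%N -> h / 2 <= normc (expi h ^+ d - 1).
Proof.
move=> h0 Nh /andP[d0 dN]; rewrite expi_expn.
have hd : h <= d%:R * h by rewrite ler_peMl ?ler1n// ltW.
have dh1 : d%:R * h <= 1.
  by apply: le_trans Nh; rewrite ler_pM2r// ler_nat ltnW.
have /half_le_sin hs : 0 <= d%:R * h <= 1 by rewrite dh1 (le_trans (ltW h0) hd).
apply: (@le_trans _ _ (sin (d%:R * h))); first by lra.
rewrite /expi /= subr0 (le_trans (ler_norm _))// -sqrtr_sqr ler_wsqrtr//.
by rewrite lerDr sqr_ge0.
Qed.

End UnitCircle.

(** * Swapping neighbouring coefficients *)

Section CoefPoly.
Variables (R : rcfType) (n : nat).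
Implicit Types x y : 'I_n.+1 -> R[i].

Definition coefpoly x : {poly R[i]} := \sum_(k < n.+1) x k *: 'X^k.

Lemma coef_coefpoly x (i : 'I_n.+1) : (coefpoly x)`_i = x i.
Proof.
rewrite coef_sum (bigD1 i)//= big1 ?addr0.
  by rewrite coefZ coefXn eqxx mulr1.
move=> j ji; rewrite coefZ coefXn (_ : (i : nat) == j = false) ?mulr0//.
by apply/negbTE; rewrite eq_sym.
Qed.

Lemma size_coefpoly x : (size (coefpoly x) <= n.+1)%N.
Proof.
apply: (leq_trans (size_sum _ _ _)); apply/bigmax_leqP => i _.
by rewrite (leq_trans (size_scale_leq _ _))// size_polyXn.
Qed.

Lemma coef_coefpoly_nat x (i : nat) : (i <= n)%N -> (coefpoly x)`_i = x (inord i).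
Proof. by move=> lein; rewrite -(coef_coefpoly x (inord i)) inordK. Qed.

(** A swap of positions [j] and [j.+1] changes both coefficients by this same jump, so the jump may
    be weighted by the larger of the two powers of [r]. *)
Definition gap (p : {poly R[i]}) (r : R) (j : nat) : R :=
  normc (p`_j - p`_j.+1) * Num.max (r ^+ j) (r ^+ j.+1).

(** There are [n.+2] sample points because [(1 - 'X) * p], to which Turan's inequality will be
    applied, may have [n.+2] coefficients. *)
Definition sumabs (p : {poly R[i]}) (w v : R[i]) : R :=
  \sum_(l < n.+2) normc p.[w * v ^+ l].

Lemma sumabs_ge0 p w v : 0 <= sumabs p w v.
Proof. by apply: sumr_ge0 => i _; rewrite normc_ge0. Qed.

Lemma le_sumabs p w v l : (l < n.+2)%N -> normc p.[w * v ^+ l] <= sumabs p w v.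
Proof.
move=> ln; rewrite /sumabs (bigD1 (Ordinal ln))//= lerDl.
by apply: sumr_ge0 => i _; rewrite normc_ge0.
Qed.

End CoefPoly.

Section Swaps.
Variables (R : rcfType) (n : nat) (par : bool) (V : {set 'I_n}).
Hypothesis Vpar : forall j, j \in V -> odd j = par.
Implicit Types (x : 'I_n.+1 -> R[i]) (F G S : {set 'I_n}) (i : nat).

Definition occurs F (i : nat) := [exists j in F, (j : nat) == i].

Lemma occursP F (j : 'I_n) : occurs F j = (j \in F).
Proof.
apply/exists_inP/idP => [[k kF /eqP kj]|jF]; last by exists j.
by rewrite (_ : j = k)//; apply/val_inj.
Qed.

(* Exchanges positions [j] and [j.+1] for each [j] in [F]; the parity condition
   makes these transpositions disjoint. *)
Definition swap F (i : 'I_n.+1) : 'I_n.+1 :=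
  inord (if occurs F i then i.+1
         else if (0 < i)%N && occurs F i.-1 then i.-1 else i).

Lemma occurs_lt F (i : nat) : occurs F i -> (i < n)%N.
Proof. by move=> /exists_inP[j _ /eqP <-]. Qed.

Lemma occurs_par F (i : nat) : F \subset V -> occurs F i -> odd i = par.
Proof. by move=> FV /exists_inP[j /(fintype.subsetP FV)/Vpar <- /eqP ->]. Qed.

Lemma val_swap F (i : 'I_n.+1) : swap F i =
  (if occurs F i then i.+1
   else if (0 < i)%N && occurs F i.-1 then i.-1 else i) :> nat.
Proof.
rewrite /swap inordK//; case: ifPn => [/occurs_lt //|_].
by case: ifPn => _; [exact: leq_ltn_trans (leq_pred _) (ltn_ord _)|exact: ltn_ord].
Qed.

Lemma swap_involutive F : F \subset V -> involutive (swap F).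
Proof.
move=> FV i; apply/val_inj => /=; rewrite val_swap.
have [iF|iF] := boolP (occurs F i).
  rewrite !val_swap iF /= iF.
  case: ifPn => // /(occurs_par FV) /=.
  by rewrite (occurs_par FV iF); case: par.
have [/andP[i0 iF']|h] := boolP ((0 < i)%N && occurs F i.-1).
  by rewrite !val_swap (negbTE iF) i0 iF' /= iF' prednK.
by rewrite val_swap (negbTE iF) (negbTE h) (negbTE iF) (negbTE h).
Qed.

Lemma coef_swap_lo x F (j : 'I_n) : F \subset V -> j \in V ->
  (coefpoly (x \o swap F))`_j =
  if j \in F then (coefpoly x)`_j.+1 else (coefpoly x)`_j.
Proof.
move=> FV jV; have jn' : (j <= n)%N by exact: ltnW.
rewrite !coef_coefpoly_nat//.
have jn : (j < n.+1)%N by rewrite ltnS.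
rewrite /= /swap inordK// occursP; case: ifPn => // jF.
case: ifPn => // /andP[j0 /(occurs_par FV)].
move=> e; have := Vpar jV; rewrite -[X in odd X](prednK j0) /= e.
by case: (par).
Qed.

Lemma coef_swap_hi x F (j : 'I_n) : F \subset V -> j \in V ->
  (coefpoly (x \o swap F))`_j.+1 =
  if j \in F then (coefpoly x)`_j else (coefpoly x)`_j.+1.
Proof.
move=> FV jV; have jn' : (j <= n)%N by exact: ltnW.
rewrite !coef_coefpoly_nat//.
have jn : (j < n.+1)%N by rewrite ltnS.
have jn2 : (j.+1 < n.+1)%N by rewrite ltnS ltn_ord.
rewrite /= /swap inordK//= occursP; case: ifPn => [|_].
  by move=> /(occurs_par FV) /=; rewrite (Vpar jV); case: par.
by case: ifPn.
Qed.

Lemma coef_swap_out x F (i : nat) : F \subset V ->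
  ~~ occurs V i -> ~~ ((0 < i)%N && occurs V i.-1) ->
  (coefpoly (x \o swap F))`_i = (coefpoly x)`_i.
Proof.
move=> FV iV iV'; have [ni|lein] := ltnP n i.
  by rewrite !nth_default// (leq_trans (size_coefpoly _)).
have sub k : occurs F k -> occurs V k.
  move=> /exists_inP[j jF jk]; apply/exists_inP; exists j => //.
  exact: (fintype.subsetP FV).
rewrite !coef_coefpoly_nat//= /swap inordK//.
rewrite (negbTE (contra (@sub _) iV)) ifN//.
by apply: contra iV' => /andP[-> /sub].
Qed.

Lemma gap_swap x F r (j : 'I_n) : F \subset V -> j \in V ->
  gap (coefpoly (x \o swap F)) r j = gap (coefpoly x) r j.
Proof.
move=> FV jV; rewrite /gap coef_swap_lo// coef_swap_hi//.
by case: ifP => // _; rewrite normc_distC.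
Qed.

(** The difference of the two swapped polynomials is supported on the pairs in [S], hence has at
    most [2 * K] terms, and is at most [2 * Y] at the sample points. Turan's inequality bounds its
    weighted coefficients by [2 * B * Y]; a pair on which [F] and [G] differ would show its whole
    gap there. *)
Lemma swap_separated x F G S (K : nat) (w v : R[i]) (eta B Y : R) :
  F \subset V -> G \subset V -> S \subset V -> (#|S| <= K)%N ->
  F :\: S = G :\: S ->
  0 < eta -> eta <= 2 -> normc v = 1 ->
  (forall d, (0 < d < n.+2)%N -> eta <= normc (v ^+ d - 1)) ->
  (2 / eta) ^+ (2 * K) <= B ->
  sumabs n (coefpoly (x \o swap F)) w v <= Y ->
  sumabs n (coefpoly (x \o swap G)) w v <= Y ->
  (forall j, j \in S -> 2 * B * Y < gap (coefpoly x) (normc w) j) ->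
  F = G.
Proof.
move=> FV GV SV SK FGS eta0 eta2 v1 sep hB YF YG big.
have Y0 : 0 <= Y by apply: le_trans YF; exact: sumabs_ge0.
set p := coefpoly (x \o swap F) - coefpoly (x \o swap G).
have pE (i : nat) : p`_i != 0 ->
    occurs S i || (0 < i)%N && occurs S i.-1.
  apply: contraNT; rewrite negb_or => /andP[iS iS'].
  have FG (j : 'I_n) : j \notin S -> (j \in F) = (j \in G).
    by move=> jS; move/setP/(_ j): FGS; rewrite !inE jS.
  rewrite coefB; have [/exists_inP[j jV /eqP ji]|iV] := boolP (occurs V i).
    rewrite -ji !coef_swap_lo// FG ?subrr//.
    by rewrite -occursP ji.
  have [/andP[i0 /exists_inP[j jV /eqP ji]]|iV'] :=
      boolP ((0 < i)%N && occurs V i.-1).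
    rewrite -(prednK i0) -ji !coef_swap_hi// FG ?subrr//.
    by move: iS'; rewrite i0 -ji occursP.
  by rewrite !coef_swap_out// subrr.
have pcard : (#|[set i : 'I_n.+2 | (p`_i != 0)%R]| <= 2 * K)%N.
  pose f (b : bool) (j : 'I_n) : 'I_n.+2 := inord (b + j).
  apply: (@leq_trans #|(f false @: S) :|: (f true @: S)|); last first.
    rewrite (leq_trans (leq_card_setU _ _))// mul2n -addnn.
    by rewrite leq_add// (leq_trans (leq_imset_card _ _)).
  apply/subset_leq_card/fintype.subsetP => i; rewrite !inE => /pE/orP[|].
    move=> /exists_inP[j jS /eqP ji]; apply/orP; left; apply/imsetP; exists j => //.
    by apply/val_inj; rewrite /f /= add0n ji inord_val.
  move=> /andP[i0 /exists_inP[j jS /eqP ji]]; apply/orP; right.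
  apply/imsetP; exists j => //; apply/val_inj.
  by rewrite /f /= ji add1n prednK// inord_val.
have szp : (size p <= n.+2)%N.
  rewrite (leq_trans (size_polyD _ _))// geq_max size_polyN.
  by rewrite !(leq_trans (size_coefpoly _)).
have p2Y l : (l < n.+2)%N -> normc p.[w * v ^+ l] <= 2 * Y.
  move=> ln; rewrite hornerD hornerN (le_trans (ler_normcB _ _))//.
  by rewrite mulr_natl mulr2n lerD// (le_trans (le_sumabs _ _ _ ln)).
have pj j : normc p`_j * normc w ^+ j <= 2 * B * Y.
  have := coef_le_max_arc eta0 eta2 (mulr_ge0 (ler0n R 2) Y0) v1 sep szp pcard p2Y j.
  by move=> /le_trans; apply; rewrite mulrA ler_wpM2r// mulrC ler_wpM2l.
apply/setP => j; have [jS|jS] := boolP (j \in S); last first.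
  by move/setP/(_ j): FGS; rewrite !inE jS.
have jV := fintype.subsetP SV _ jS.
apply/eqP/negPn/negP => jFG.
have nlo : normc p`_j = normc ((coefpoly x)`_j - (coefpoly x)`_j.+1).
  rewrite coefB !coef_swap_lo//.
  by move: jFG; case: (j \in F); case: (j \in G) => // _; rewrite normc_distC.
have nhi : normc p`_j.+1 = normc ((coefpoly x)`_j - (coefpoly x)`_j.+1).
  rewrite coefB !coef_swap_hi//.
  by move: jFG; case: (j \in F); case: (j \in G) => // _; rewrite normc_distC.
have := big _ jS; rewrite ltNge => /negP; apply.
by rewrite /gap; case: (leP (normc w ^+ j)) => _; [rewrite -nhi|rewrite -nlo]; exact: pj.
Qed.

Definition degenerate (K : nat) (B : R) (w v : R[i]) x : bool :=
  [exists S : {set 'I_n}, [&& S \subset V, #|S| == K &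
    [forall j in S, 2 * B * sumabs n (coefpoly x) w v
                    < gap (coefpoly x) (normc w) j]]].

(** A degenerate configuration is determined by its part outside a fixed set [S] of [K] pairs, so
    there are at most [2 ^ (#|V| - K)] of them. *)
Lemma card_degenerate_swaps x (K : nat) (w v : R[i]) (eta B : R) :
  0 < eta -> eta <= 2 -> normc v = 1 ->
  (forall d, (0 < d < n.+2)%N -> eta <= normc (v ^+ d - 1)) ->
  (2 / eta) ^+ (2 * K) <= B ->
  (#|[set F in powerset V | degenerate K B w v (x \o swap F)]| * 2 ^ K
    <= 2 ^ #|V|)%N.
Proof.
move=> eta0 eta2 v1 sep hB; set D := [set F in _ | _].
have B0 : 0 <= B by apply: le_trans hB; rewrite exprn_ge0// divr_ge0// ltW.
have [->|[F0 F0D]] := set_0Vmem D; first by rewrite cards0 mul0n.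
pose Y F := sumabs n (coefpoly (x \o swap F)) w v.
(* Taking the degenerate configuration with the largest sample sum lets its witness [S] serve for
   all the others: gaps are invariant under swaps and exceed [2 * B] times every sample sum in
   [D]. *)
case: (@Order.TotalTheory.arg_maxP _ _ _ F0 (mem D) Y F0D) => F1 F1D F1max.
have {}F1D : F1 \in D by [].
move: (F1D); rewrite /D inE powersetE => /andP[F1V /existsP[S /and3P[SV /eqP SK]]].
move=> /'forall_implyP big.
have inj : {in D &, injective (fun F => F :\: S)}.
  move=> F G FD GD /= FGS.
  move: (FD) (GD); rewrite /D !inE => /andP[FV _] /andP[GV _].
  apply: (@swap_separated x F G S K w v eta B (Y F1)) => //.
  - by rewrite SK.
  - exact: F1max.
  - exact: F1max.
  - move=> j jS; have := big j jS; rewrite gap_swap//.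
    exact: (fintype.subsetP SV).
have : (#|D| <= #|powerset (V :\: S)|)%N.
  rewrite -(card_in_imset inj); apply/subset_leq_card/fintype.subsetP => G.
  by move=> /imsetP[F]; rewrite /D !inE => /andP[FV _] ->; rewrite finset.setSD.
rewrite card_powerset => /leq_trans-/(_ _ (leqnn _)) h.
rewrite (leq_trans (leq_mul h (leqnn _)))// -expnD leq_exp2l//.
by rewrite cardsD (finset.setIidPr SV) SK subnK// -SK subset_leq_card.
Qed.

End Swaps.

(** * Bounding all terms by the samples when few gaps are wide *)

Section LowerBound.
Variables (R : rcfType) (n : nat).
Implicit Types (x : 'I_n.+1 -> R[i]).

(* Multiplying by [1 - 'X] turns differences of consecutive coefficients into
   coefficients. *)
Lemma coef_le_few_gaps x (m : nat) (w v : R[i]) (eta tau : R) :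
  0 < eta -> eta <= 2 -> 0 <= tau -> normc v = 1 -> w != 0 ->
  (forall d, (0 < d < n.+2)%N -> eta <= normc (v ^+ d - 1)) ->
  (#|[set j : 'I_n | (tau < gap (coefpoly x) (normc w) j)%R]| <= m)%N ->
  forall i, normc (coefpoly x)`_i * normc w ^+ i <=
    n.+1%:R * ((2 / eta) ^+ m.+2 *
       (2 * sumabs n (coefpoly x) w v + n.+2%:R * tau) + tau).
Proof.
move=> eta0 eta2 tau0 v1 w0 sep card_big i.
set p := coefpoly x; set r := normc w; set Y := sumabs n p w v.
have r0 : 0 < r by rewrite normc_gt0.
have Y0 : 0 <= Y := sumabs_ge0 _ _ _ _.
(* [2 * rho] bounds [|1 - z|] on the circle of radius [r]. *)
pose rho := Num.max 1 r.
have rho1 : 1 <= rho by rewrite le_max lexx.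
have rrho : r <= rho by rewrite le_max lexx orbT.
have rho0 : 0 <= rho by apply: le_trans rho1.
have taurho : 0 <= tau * rho by rewrite mulr_ge0.
pose q := (1 - 'X) * p.
have qc j : q`_j = p`_j - (if j is j'.+1 then p`_j' else 0).
  by rewrite /q mulrBl mul1r coefB coefXM; case: j.
have szp : (size p <= n.+1)%N := size_coefpoly x.
have szq : (size q <= n.+2)%N.
  apply/leq_sizeP => j jn; rewrite qc nth_default ?(leq_trans szp) 1?ltnW//.
  case: j jn => [//|j jn]; rewrite [p`_j]nth_default ?subr0//.
  by rewrite (leq_trans szp).
pose G := (2 / eta) ^+ m.+2 * (2 * Y + n.+2%:R * tau) + tau.
have e0 : 0 <= 2 / eta by rewrite divr_ge0// ltW.
have G0 : 0 <= G by rewrite addr_ge0// mulr_ge0 ?exprn_ge0// addr_ge0// mulr_ge0.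
pose bigq j := tau * rho < normc q`_j * r ^+ j.
(* The discarded coefficients of [q] contribute at most [n.+2 * tau * rho] at each sample point, so
   Turan's inequality can be applied to the sparse part [qE]. *)
pose qE := \poly_(j < n.+2) (if bigq j then q`_j else 0).
have qEc j : (j < n.+2)%N -> qE`_j = if bigq j then q`_j else 0.
  by move=> jn; rewrite coef_poly jn.
(* The two extra positions are the end coefficients [0] and [n.+1] of [q], which are not differences
   of two coefficients of [p]. *)
have cardE : (#|[set j : 'I_n.+2 | (qE`_j != 0)%R]| <= m.+2)%N.
  pose S := [set j : 'I_n | (tau < gap p r j)%R].
  pose f (j : 'I_n) : 'I_n.+2 := inord j.+1.
  apply: (@leq_trans #|[set ord0; ord_max] :|: (f @: S)|); last first.
    rewrite (leq_trans (leq_card_setU _ _))// cards2 -[in X in (_ <= X)%N]add2n.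
    by rewrite leq_add// (leq_trans (leq_imset_card _ _)).
  apply/subset_leq_card/fintype.subsetP => j; rewrite !inE qEc//.
  case: ifPn => [bj _|_]; last by rewrite eqxx.
  have [->//|j0] := eqVneq j ord0.
  have [->//|jmax] := eqVneq j ord_max.
  have j0' : (0 < j)%N by rewrite lt0n.
  have jn : (j.-1 < n)%N.
    rewrite -ltnS prednK// ltn_neqAle -ltnS ltn_ord andbT.
    by rewrite -[(j : nat) == n.+1]/(j == ord_max).
  apply/orP; right; apply/imsetP; exists (Ordinal jn); last first.
    by apply/val_inj; rewrite /f /= inordK prednK.
  rewrite inE; move: bj; rewrite /bigq qc /gap /=.
  case: (j : nat) j0' => [//|k] _ /=.
  rewrite normc_distC => h; apply: le_lt_trans (lt_le_trans h _).
    by rewrite ler_peMr.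
  by rewrite ler_wpM2l ?normc_ge0// le_max lexx orbT.
have nz l : normc (w * v ^+ l) = r by rewrite normcM normcX v1 expr1n mulr1.
have hE l : (l < n.+2)%N ->
    normc qE.[w * v ^+ l] <= rho * (2 * Y + n.+2%:R * tau).
  move=> ln; 
  have -> : qE.[w * v ^+ l] = q.[w * v ^+ l] - (q - qE).[w * v ^+ l].
    by rewrite hornerD hornerN opprB addrC subrK.
  rewrite (le_trans (ler_normcB _ _))// mulrDr lerD//.
    rewrite /q hornerM normcM mulrA ler_pM ?normc_ge0//; last exact: le_sumabs.
    rewrite !hornerE (le_trans (ler_normcB _ _))// normc_one nz mulr_natr mulr2n.
    by rewrite lerD.
  have szB : (size (q - qE)%R <= n.+2)%N.
    rewrite (leq_trans (size_polyD _ _))// geq_max size_polyN szq.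
    exact: size_poly.
  rewrite (horner_coef_wide _ szB) (le_trans (ler_normc_sum _ _ _))//.
  apply: (@le_trans _ _ (\sum_(j < n.+2) (tau * rho))); last first.
    by rewrite sumr_const card_ord -[leLHS]mulr_natl [tau * _]mulrC mulrCA.
  apply: ler_sum => j _; rewrite normcM normcX nz coefB qEc//.
  case: ifPn; last by rewrite subr0 -leNgt.
  by rewrite subrr normc_zero mul0r.
have hq j : normc q`_j * r ^+ j <= rho * G.
  have [jn|jn] := ltnP j n.+2; last first.
    by rewrite nth_default ?(leq_trans szq)// normc_zero mul0r mulr_ge0.
  have [bj|] := boolP (bigq j); last first.
    rewrite -leNgt => /le_trans; apply; rewrite mulrC ler_wpM2l// lerDr.
    by rewrite mulr_ge0 ?exprn_ge0// addr_ge0// mulr_ge0.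
  have := @coef_le_max_arc _ n.+2 m.+2 qE w v eta
    (rho * (2 * Y + n.+2%:R * tau)) eta0 eta2 _ v1 sep (size_poly _ _) cardE hE j.
  rewrite qEc// bj => /(_ _)/le_trans; apply.
    by rewrite mulr_ge0// addr_ge0// mulr_ge0.
  by rewrite mulrCA ler_wpM2l// lerDl.
have [ni|lein] := ltnP n i.
  by rewrite nth_default ?(leq_trans szp)// normc_zero mul0r mulr_ge0.
have lt_sum a b : (a <= b <= n.+1)%N -> \sum_(a <= j < b) G <= n.+1%:R * G.
  move=> /andP[ab bn]; rewrite sumr_const_nat -[leLHS]mulr_natl ler_wpM2r// ler_nat.
  by rewrite (leq_trans (leq_subr _ _)).
(* The coefficients of [p] are recovered by telescoping those of [q], from the left if [r <= 1] and
   from the right otherwise, so that the weights [r ^+ j] met on the way dominate [r ^+ i]. In the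
   second case the extra power of [r] absorbs [rho]. *)
have [r1|r1] := leP r 1.
- have rho_1 : rho = 1 by rewrite /rho max_l.
  have tele k : p`_k = \sum_(0 <= j < k.+1) q`_j.
    elim: k => [|k IH]; first by rewrite big_nat1 qc subr0.
    by rewrite big_nat_recr//= -IH qc addrC subrK.
  rewrite tele (le_trans (ler_wpM2r (exprn_ge0 _ (ltW r0)) (ler_normc_sum _ _ _)))//.
  rewrite mulr_suml; apply: le_trans (lt_sum 0%N i.+1 _); last by rewrite ltnS.
  apply: ler_sum_nat => j /andP[_ ji]; rewrite -[leRHS]mul1r -rho_1.
  apply: le_trans (hq j); rewrite ler_wpM2l ?normc_ge0//.
  by rewrite ler_wiXn2l// ltW.
- have rho_r : rho = r by rewrite /rho max_r// ltW.
  have tele k : \sum_(i.+1 <= j < i.+1 + k) q`_j = p`_(i + k) - p`_i.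
    elim: k => [|k IH]; first by rewrite !addn0 big_geq// subrr.
    rewrite addnS big_nat_recr ?leq_addr//= IH addSn qc addnS.
    by rewrite addrC addrA subrK.
  have {}tele : p`_i = - \sum_(i.+1 <= j < n.+2) q`_j.
    have := tele (n.+1 - i)%N; rewrite addSn subnKC ?(leqW lein)// => ->.
    by rewrite [p`_n.+1]nth_default// sub0r opprK.
  rewrite tele normc_opp.
  rewrite (le_trans (ler_wpM2r (exprn_ge0 _ (ltW r0)) (ler_normc_sum _ _ _)))//.
  rewrite mulr_suml; apply: le_trans (lt_sum i n.+1 _); last by rewrite leqnn leqW.
  rewrite big_add1/=; apply: ler_sum_nat => j /andP[ij _].
  rewrite -(ler_pM2l r0) -[in leRHS]rho_r; apply: le_trans (hq j.+1).
  by rewrite mulrCA -exprS ler_wpM2l ?normc_ge0// ler_weXn2l// ltW.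
Qed.

End LowerBound.

(** * Zeros in one cell of the curve *)

Section Cell.
Variable R : realType.
Implicit Types (s t : R).

Lemma expR1_le4 : expR 1 <= 4 :> R.
Proof.
have h : 1 / 2 <= expR (- (1 / 2)) :> R by have := expR_ge1Dx (- (1 / 2) : R); lra.
have -> : 1 = 1 / 2 + 1 / 2 :> R by lra.
have h2 : expR (1 / 2) <= 2 :> R.
  by rewrite -[1 / 2]opprK expRN -[leRHS]invrK lef_pV2 ?posrE ?expR_gt0//; lra.
rewrite expRD; apply: (le_trans (ler_pM _ _ h2 h2)); rewrite ?expR_ge0//; lra.
Qed.

Lemma ler_dist_expR1 t : `|t| <= 1 / 2 -> `|expR t - 1| <= 2 * `|t|.
Proof.
move=> ht; have [t0|t0] := leP 0 t.
  rewrite ger0_norm ?subr_ge0 -?expR0 ?ler_expR//.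
  rewrite expR0 (ger0_norm t0) in ht *.
  have h : 1 - t <= expR (- t) by have := expR_ge1Dx (- t); lra.
  have h1 : 0 < 1 - t by lra.
  have h2 : expR t <= (1 - t)^-1.
    by rewrite -[t in leLHS]opprK expRN lef_pV2 ?posrE ?expR_gt0.
  suff : (1 - t)^-1 <= 1 + 2 * t by lra.
  by rewrite -[leLHS]mul1r ler_pdivrMr//; nra.
rewrite ler0_norm ?subr_le0 -?expR0 ?ler_expR ?ltW// ltr0_norm//.
by have := expR_ge1Dx t; rewrite expR0; lra.
Qed.

Variables (L : R) (theta : R -> R).
Hypothesis L0 : 0 <= L.
Hypothesis thetaL : forall r1 r2 : R, 0 < r1 -> 0 < r2 ->
  `|theta r1 - theta r2| <= L * `|ln (r1 / r2)|.

Definition curve s : R[i] := (expR s)%:C * expi (theta (expR s)).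

Lemma normc_real (a : R) : 0 <= a -> normc a%:C = a.
Proof. by move=> a0; rewrite /= expr0n/= addr0 sqrtr_sqr ger0_norm. Qed.

Lemma normc_curve s : normc (curve s) = expR s.
Proof. by rewrite normcM normc_expi mulr1 normc_real// expR_ge0. Qed.

Lemma theta_lipschitz s t :
  `|theta (expR s) - theta (expR t)| <= L * `|s - t|.
Proof.
have := thetaL (expR_gt0 s) (expR_gt0 t).
by rewrite -expRN -expRD expRK.
Qed.

(** The displacement splits into a rotation, by an angle at most [L * t + a], and a radial change,
    controlled by [|exp u - 1| <= 2 |u|] for small [u]. *)
Lemma dist_curve s0 s t a : `|s0 - s| <= t -> t <= 1 / 2 -> 0 <= a ->
  normc (curve s0 * expi a - curve s) <= expR s0 * (2 * t + 2 * L * t + 2 * a).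
Proof.
move=> hs ht a0; rewrite /curve -mulrA -expiD.
set e0 := expi _; set e1 := expi _.
have -> : (expR s0)%:C * e0 - (expR s)%:C * e1 =
    (expR s0)%:C * (e0 - e1) + ((expR s0)%:C - (expR s)%:C) * e1.
  by ring.
rewrite (le_trans (ler_normcD _ _))// !normcM normc_expi mulr1.
rewrite (normc_real (expR_ge0 _)).
have -> : (expR s0)%:C - (expR s)%:C = (expR s0 - expR s)%:C by rewrite rmorphB.
have -> : expR s0 * (2 * t + 2 * L * t + 2 * a)
   = expR s0 * (2 * (L * t + a)) + expR s0 * (2 * t) by ring.
rewrite lerD//.
  rewrite ler_wpM2l ?expR_ge0// (le_trans (ler_dist_expi _ _))// ler_wpM2l//.
  rewrite addrAC (le_trans (ler_normD _ _))// lerD ?(ger0_norm a0)//.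
  by rewrite (le_trans (theta_lipschitz _ _))// ler_wpM2l.
rewrite /= expr0n/= addr0 sqrtr_sqr.
have -> : expR s0 - expR s = expR s0 * (1 - expR (s - s0)).
  by rewrite mulrBr mulr1 -expRD [s0 + _]addrC subrK.
rewrite normrM (ger0_norm (expR_ge0 _)) ler_wpM2l ?expR_ge0// distrC.
rewrite distrC in hs.
by rewrite (le_trans (ler_dist_expR1 _))// ?ler_wpM2l// (le_trans hs).
Qed.

(* The constant makes twice the distance between two points of a cell smaller than
   the distance from the cell to the boundary of the annulus of [cell_zeros]. *)
Definition mesh : R := (60 * (2 + L))^-1.

Lemma mesh_gt0 : 0 < mesh.
Proof. by rewrite invr_gt0 mulr_gt0// ltr_wpDr. Qed.

Lemma mesh_le : mesh <= 1 / 120.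
Proof.
have h : 120 <= 60 * (2 + L) by have := L0; lra.
by rewrite div1r /mesh lef_pV2 ?posrE// (lt_le_trans _ h).
Qed.

Lemma meshL : (2 + L) * mesh = 1 / 60.
Proof.
have h : 0 < 2 + L by rewrite ltr_wpDr.
by rewrite /mesh invfM mulrCA divff ?gt_eqF// mulr1 div1r.
Qed.

Variable n : nat.
Hypothesis n2 : (2 <= n)%N.

Let nR2 : 2 <= n%:R :> R. Proof. by rewrite ler_nat. Qed.

(** The argument step between sample points: [n.+2] steps turn by at most [mesh / n], the smallest
    half-width of a cell. *)
Definition angle : R := mesh / (2 * n%:R ^+ 2).

Lemma angle_gt0 : 0 < angle.
Proof. by rewrite divr_gt0 ?mesh_gt0// mulr_gt0// exprn_gt0// ltr0n ltnW. Qed.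

Lemma angle_le : n.+2%:R * angle <= mesh / n%:R.
Proof.
rewrite /angle.
have -> : mesh / n%:R = (2 * n%:R) * (mesh / (2 * n%:R ^+ 2)).
  by field; rewrite pnatr_eq0; lia.
rewrite ler_wpM2r// ?(ltW angle_gt0)//.
by rewrite -natrM ler_nat; lia.
Qed.

Lemma angle_small : n.+2%:R * angle <= 1.
Proof.
rewrite (le_trans angle_le)// ler_pdivrMr; last by rewrite ltr0n ltnW.
by have := mesh_le; have := nR2; lra.
Qed.

(** In the application [b] is the crossing of term [nu] nearest to [s]. *)
Definition dominates (x : 'I_n.+1 -> R[i]) (nu : 'I_n.+1) (b s : R) :=
  forall j : 'I_n.+1, normc (x j) * expR (j%:R * s)
    <= normc (x nu) * expR (nu%:R * s - `|j%:R - nu%:R| * `|s - b|).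

(** Cells scale with their distance from the breakpoint. The floor [1 / n] is harmless, since over a
    log-distance [1 / n] the ratio of two terms changes by at most a factor [e]. *)
Definition cell_radius (o : R) := Num.max `|o| n%:R^-1.

(** Moving from [s] to the centre costs [mesh * t0] per index, and half of the decay rate is kept.
    If [t0 = |o|] nothing is lost; if [t0 = 1 / n] the exponent grows by at most 1, whence the
    factor [4 >= e]. *)
Lemma dominates_center x nu b o s (j : 'I_n.+1) :
  dominates x nu b s -> `|s - (b + o)| <= mesh * cell_radius o ->
  normc (x j) * expR (j%:R * (b + o) + `|j%:R - nu%:R| * (cell_radius o / 2))
    <= 4 * (normc (x nu) * expR (nu%:R * (b + o))).
Proof.
move=> dom hs; set s0 := b + o in hs *; set t0 := cell_radius o in hs *.
set d := `|j%:R - nu%:R|.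
have d0 : 0 <= d := normr_ge0 _.
have dn : d <= n%:R.
  rewrite /d ler_norml; have := ltn_ord j; have := ltn_ord nu.
  rewrite !ltnS -!(ler_nat R) => h1 h2; have := ler0n R j; have := ler0n R nu.
  by move=> ? ?; apply/andP; split; lra.
have so : `|o| <= `|s - b| + mesh * t0.
  have -> : o = (s - b) - (s - s0) by rewrite /s0; lra.
  by rewrite (le_trans (ler_normB _ _))// lerD2l.
have key : d * (mesh * t0) - d * `|s - b| + d * (t0 / 2) <= 1.
  have m0 := mesh_gt0; have m1 := mesh_le.
  have to : 0 < n%:R^-1 :> R by rewrite invr_gt0 ltr0n ltnW.
  have dinv : d * n%:R^-1 <= 1 by rewrite ler_pdivrMr ?mul1r// ltr0n ltnW.
  have : d * (mesh * t0 - `|s - b| + t0 / 2) <= d * (2 * mesh * t0 - `|o| + t0 / 2).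
    by rewrite ler_wpM2l//; lra.
  rewrite mulrDr mulrBr => /le_trans; apply.
  rewrite /t0 /cell_radius; case: (leP `|o|) => ho.
    apply: le_trans dinv; rewrite ler_wpM2l//.
    have : mesh * n%:R^-1 <= 1 / 120 * n%:R^-1 by rewrite ler_wpM2r// ltW.
    by have := normr_ge0 o; lra.
  apply: (@le_trans _ _ 0) => //; rewrite mulr_ge0_le0//.
  have : mesh * `|o| <= 1 / 120 * `|o| by rewrite ler_wpM2r.
  by have := normr_ge0 o; lra.
have js : (j%:R - nu%:R) * (s0 - s) <= d * (mesh * t0).
  rewrite (le_trans (ler_norm _))// normrM ler_wpM2l//.
  by rewrite distrC.
have -> : j%:R * s0 + d * (t0 / 2) =
    j%:R * s + (j%:R * (s0 - s) + d * (t0 / 2)) by ring.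
rewrite expRD [leLHS]mulrA.
apply: (le_trans (ler_wpM2r (expR_ge0 _) (dom j))).
rewrite -mulrA -expRD [leRHS]mulrCA ler_wpM2l ?normc_ge0//.
apply: (@le_trans _ _ (expR (1 + nu%:R * s0))).
  by rewrite ler_expR -/d; lra.
by rewrite expRD ler_wpM2r ?expR_ge0// expR1_le4.
Qed.

(** [annulus_zeros] is applied at every sample point, on the annulus of log-radii within [t0 / 2] of
    the centre. The decay given by [dominates_center] exactly offsets the weights of the annulus, so
    each of the [n.+1] terms of the norm is at most [4 * M0]. *)
Lemma cell_zeros x nu b o (zs : seq R[i]) q :
  `|o| <= 2 ->
  coefpoly x = \prod_(zeta <- zs) ('X - zeta%:P) * q ->
  (forall zeta, zeta \in zs -> exists s,
    [/\ zeta = curve s, `|s - (b + o)| <= mesh * cell_radius o & dominates x nu b s]) ->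
  (0 < size zs)%N ->
  2 ^+ size zs * sumabs n (coefpoly x) (curve (b + o)) (expi angle)
   <= 4 * n.+1%:R * n.+2%:R * (normc (x nu) * expR (b + o) ^+ nu).
Proof.
move=> o2 xq zsP zs0; set s0 := b + o in zsP *; set t0 := cell_radius o in zsP *.
set p := coefpoly x; set r := expR s0; set M0 := _ * r ^+ nu.
have to : 0 < n%:R^-1 :> R by rewrite invr_gt0 ltr0n ltnW.
have ton : n%:R^-1 <= 1 / 2 :> R by rewrite div1r lef_pV2 ?posrE// ltr0n ltnW.
have t00 : 0 < t0 by rewrite /t0 /cell_radius lt_max to orbT.
have tn : n%:R^-1 <= t0 by rewrite /t0 /cell_radius le_max lexx orbT.
have t02 : t0 <= 2 by rewrite /t0 /cell_radius ge_max o2; lra.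
have r0 : 0 < r by exact: expR_gt0.
have m0 := mesh_gt0; have m1 := mesh_le.
have mt0 : 0 <= mesh * t0 by rewrite mulr_ge0// ltW.
have mt : mesh * t0 <= 1 / 120 * t0 by rewrite ler_wpM2r// ltW.
have dom j : normc (x j) * expR (j%:R * s0 + `|j%:R - nu%:R| * (t0 / 2)) <= 4 * M0.
  have : head 0 zs \in zs by move: zs0; case: (zs) => //= a l _; exact: mem_head.
  move=> /zsP[s [_ hs hd]]; have := dominates_center j hd hs.
  by rewrite [expR (nu%:R * _)]expRM_natl.
have M00 : 0 <= M0 by rewrite mulr_ge0 ?normc_ge0 ?exprn_ge0// ltW.
pose Rp := r * expR (t0 / 2); pose Rm := r * expR (- (t0 / 2)).
have Rm0 : 0 < Rm by rewrite mulr_gt0 ?expR_gt0.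
have e4 : 1 / 4 <= expR (- (t0 / 2)).
  rewrite expRN div1r lef_pV2 ?posrE ?expR_gt0//.
  by apply: le_trans expR1_le4; rewrite ler_expR; lra.
(* The outer boundary is at distance at least [r * t0 * 59 / 120] from the cell and the inner one at
   least [r * t0 * 49 / 400], as [exp (- t0 / 2) >= 1 / 4]; twice the distance from a sample point
   to a zero is at most [4 * (2 + L) * mesh * r * t0 = r * t0 / 15]. *)
pose kappa := r * (t0 / 10).
have kappa0 : 0 <= kappa by rewrite mulr_ge0// ?(ltW r0)//; lra.
have W : r ^+ nu * (upper_norm Rp nu n.+1 p + lower_norm Rm nu p)
    <= n.+1%:R * (4 * M0).
  rewrite mulrDr addrC /upper_norm /lower_norm !mulr_sumr.
  have -> : n.+1%:R * (4 * M0) = \sum_(0 <= i < n.+1) (4 * M0).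
    by rewrite sumr_const_nat subn0 mulr_natl.
  have nun : (nu <= n.+1)%N by exact: ltnW.
  rewrite [leRHS](@big_cat_nat _ _ _ nu)//= lerD//.
    apply: ler_sum_nat => i /andP[_ inu].
    have iN : (i < n.+1)%N by exact: ltn_trans (ltn_ord nu).
    apply: le_trans (dom (Ordinal iN)); rewrite -(coef_coefpoly x (Ordinal iN)) /=.
    rewrite mulrCA ler_wpM2l ?normc_ge0//.
    rewrite /Rm exprMn invfM expRD [expR (i%:R * _)]expRM_natl -/r mulrA.
    rewrite -[expR (- (t0 / 2)) ^+ _]expRM_natl -expRN.
    have -> : `|i%:R - nu%:R| = (nu - i)%:R :> R.
      by rewrite distrC natrB 1?ltnW// ger0_norm// subr_ge0 ler_nat ltnW.
    rewrite mulrN opprK ler_wpM2r ?expR_ge0//.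
    by rewrite ler_pdivrMr ?exprn_gt0// -exprD subnKC// ltnW.
  apply: ler_sum_nat => i /andP[nui iN].
  apply: le_trans (dom (Ordinal iN)); rewrite -(coef_coefpoly x (Ordinal iN)) /=.
  rewrite mulrCA ler_wpM2l ?normc_ge0//.
  rewrite /Rp exprMn expRD [expR (i%:R * _)]expRM_natl -/r mulrA -exprD subnKC//.
  by rewrite -natrB// ger0_norm// expRM_natl.
rewrite /sumabs mulr_sumr.
apply: (@le_trans _ _ (\sum_(l < n.+2) (n.+1%:R * (4 * M0)))); last first.
  rewrite sumr_const card_ord -[leLHS]mulr_natl le_eqVlt.
  by apply/orP; left; apply/eqP; ring.
apply: ler_sum => l _.
set z := curve s0 * _.
have zr : normc z = r by rewrite normcM normcX normc_expi expr1n mulr1 normc_curve.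
apply: le_trans W; rewrite -zr.
apply: (@annulus_zeros R Rp Rm kappa nu n.+1 zs p q z) => //.
- exact: ltnW.
- exact: size_coefpoly.
- move=> _ /zsP[s [-> hs _]]; rewrite normc_curve /Rp /kappa.
  have -> : expR s = r * expR (s - s0) by rewrite -expRD addrC subrK.
  rewrite -mulrBr ler_wpM2l ?(ltW r0)//.
  have : expR (s - s0) <= expR (mesh * t0).
    by rewrite ler_expR (le_trans (ler_norm _)).
  have -> : expR (t0 / 2) = expR (mesh * t0) * expR (t0 / 2 - mesh * t0).
    by rewrite -expRD addrC subrK.
  have := expR_ge1Dx (t0 / 2 - mesh * t0).
  have : 1 <= expR (mesh * t0) by rewrite -expR0 ler_expR.
  set A := expR (mesh * t0); set D := expR (_ - _); set D2 := expR (s - s0).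
  move=> hA hD hD2.
  suff : A * D - A >= t0 / 10 by lra.
  have : A * (t0 / 10) <= A * (D - 1) by rewrite ler_wpM2l//; lra.
  have : 1 * (t0 / 10) <= A * (t0 / 10) by rewrite ler_wpM2r//; lra.
  by lra.
- move=> _ /zsP[s [-> hs _]]; rewrite normc_curve /Rm /kappa.
  have -> : expR s = r * expR (s - s0) by rewrite -expRD addrC subrK.
  rewrite -mulrBr ler_wpM2l ?(ltW r0)//.
  have : expR (- (mesh * t0)) <= expR (s - s0).
    by rewrite ler_expR; move: hs; rewrite ler_norml => /andP[].
  have -> : expR (- (mesh * t0)) = expR (- (t0 / 2)) * expR (t0 / 2 - mesh * t0).
    by rewrite -expRD; congr expR; ring.
  have := expR_ge1Dx (t0 / 2 - mesh * t0).
  set A := expR (- (t0 / 2)) in e4 *; set D := expR (_ - _); set D2 := expR (s - s0).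
  move=> hD hD2.
  suff : A * D - A >= t0 / 10 by lra.
  have : A * (t0 * (49 / 100)) <= A * (D - 1) by rewrite ler_wpM2l//; lra.
  have : 1 / 4 * (t0 * (49 / 100)) <= A * (t0 * (49 / 100)) by rewrite ler_wpM2r//; lra.
  by lra.
- move=> _ /zsP[s [-> hs _]].
  have la0 : 0 <= l%:R * angle by rewrite mulr_ge0// ltW// angle_gt0.
  have la : l%:R * angle <= mesh * t0.
    apply: (@le_trans _ _ (n.+2%:R * angle)).
      by rewrite ler_wpM2r ?(ltW angle_gt0)// ler_nat ltnW.
    by rewrite (le_trans angle_le)// ler_wpM2l// ltW.
  rewrite /z expi_expn; rewrite distrC in hs.
  have := dist_curve hs _ la0 => /(_ _)/(ler_wpM2l (ler0n R 2)) h.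
  apply: le_trans (h _) _; first by lra.
  rewrite /kappa -/r mulrCA ler_wpM2l ?(ltW r0)//.
  have -> : 2 * L * (mesh * t0) = 2 * (1 / 60 * t0) - 4 * (mesh * t0).
    by rewrite -meshL; ring.
  by lra.
- rewrite zr /Rm /Rp; apply/andP.
  split; [apply: ler_piMr|apply: ler_peMr]; rewrite ?(ltW r0)//.
    by rewrite -[leRHS]expR0 ler_expR; lra.
  by rewrite -[leLHS]expR0 ler_expR; lra.
Qed.

End Cell.

(** * Binary logarithms and exponent bookkeeping *)

Definition log2n n := trunc_log 2 n.
(* [2 ^ (npairs n)] exceeds [n] times the number of cells, up to a factor [log n]. *)
Definition npairs n := (8 * log2n n)%N.

Lemma log2n_gt0 n : (2 <= n)%N -> (0 < log2n n)%N.
Proof. by rewrite trunc_log_gt0. Qed.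

Lemma leq_log2n n : (2 <= n)%N -> (n < 2 ^ (2 * log2n n))%N.
Proof.
move=> n2; apply: leq_trans (trunc_log_ltn n (ltnSn 1)) _.
by rewrite leq_exp2l// mul2n -addnn -addn1 leq_add2l log2n_gt0.
Qed.

(** With [m = n] and [l = log2n n], these turn the polynomial factors in the cell estimate into
    powers of 2. *)
Lemma pow2_bounds (m l : nat) : (0 < l)%N -> (m < 2 ^ (2 * l))%N ->
  [/\ (m.+2 <= 2 ^ (3 * l))%N, (2 * m + 8 <= 2 ^ (5 * l))%N,
      (4 <= 2 ^ (2 * l))%N & (8 * m ^ 2 <= 2 ^ (7 * l))%N].
Proof.
move=> l0 ml.
have p2 : (2 ^ 1 <= 2 ^ l)%N by rewrite leq_exp2l.
have p4 : (2 ^ 2 <= 2 ^ (2 * l))%N by rewrite leq_exp2l//; lia.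
have p8 : (2 ^ 3 <= 2 ^ (3 * l))%N by rewrite leq_exp2l//; lia.
have e3 : (2 ^ (3 * l) = 2 ^ (2 * l) * 2 ^ l)%N by rewrite -expnD; congr expn; lia.
have e5 : (2 ^ (5 * l) = 2 ^ (2 * l) * 2 ^ (3 * l))%N.
  by rewrite -expnD; congr expn; lia.
have e7 : (2 ^ (7 * l) = 2 ^ (3 * l) * (2 ^ (2 * l) * 2 ^ (2 * l)))%N.
  by rewrite -!expnD; congr expn; lia.
split; rewrite ?e5 ?e7.
- rewrite e3; move: (2 ^ (2 * l))%N (2 ^ l)%N ml p2 => A B; nia.
- move: (2 ^ (2 * l))%N (2 ^ (3 * l))%N ml p8 => A B; nia.
- exact: p4.
- by rewrite leq_mul// -mulnn leq_mul// ltnW.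
Qed.

Lemma exponent_bound (a l : nat) : (0 < l)%N ->
  (2 * l + 2 * l + 3 * l + (2 * l + 5 * l + (7 + a) * l * (38 * l))
   <= (14 + 38 * (7 + a)) * l ^ 2)%N.
Proof. by move=> l0; rewrite -mulnn; nia. Qed.

(** * The number of zeros in a cell that is not bad *)

Section CellBound.
Variables (R : realType) (L : R) (theta : R -> R).
Hypothesis L0 : 0 <= L.
Hypothesis thetaL : forall r1 r2 : R, 0 < r1 -> 0 < r2 ->
  `|theta r1 - theta r2| <= L * `|ln (r1 / r2)|.
Variable n : nat.
Hypothesis n2 : (2 <= n)%N.
Implicit Types (x : 'I_n.+1 -> R[i]) (nu k : 'I_n.+1) (o : R).

(* The loss in [coef_le_max_arc] for polynomials with [2 * npairs n] terms. *)
Definition threshold : R := (2 / (angle L n / 2)) ^+ (2 * npairs n).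

(** The fixed parity makes the swaps disjoint. Pairs touching [nu] or [k] are excluded so that a
    swap leaves [crossing x nu k], and with it the centre of the cell, unchanged. *)
Definition free_pairs (par : bool) nu k : {set 'I_n} :=
  [set j : 'I_n | (odd j == par) && [&& (j : nat) != nu, j.+1 != nu :> nat,
                                        (j : nat) != k & j.+1 != k :> nat]].

(* The log-radius at which the terms of index [nu] and [k] have the same modulus,
   provided both coefficients are nonzero (recall that [ln 0 = 0]). *)
Definition crossing x nu k : R :=
  (ln (normc (x nu)) - ln (normc (x k))) / (k%:R - nu%:R).

Definition center x nu k o : R[i] := curve theta (crossing x nu k + o).

Definition bad_cell par nu k o x : bool :=
  degenerate (free_pairs par nu k) (npairs n) threshold (center x nu k o)
    (expi (angle L n)) x.

Lemma ex_mesh_exp : exists a : nat, (mesh L)^-1 <= 2 ^+ a.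
Proof.
exists (Num.trunc (mesh L)^-1).+1; apply: ltW; apply: (lt_trans (truncnS_gt _)).
by rewrite -natrX ltr_nat ltn_expl.
Qed.

Let eta0 : 0 < angle L n / 2.
Proof. by rewrite divr_gt0// angle_gt0. Qed.

Let angle1 : angle L n <= 1.
Proof.
apply: le_trans (angle_small L0 n2).
by rewrite ler_peMl ?ler1n// ltW// angle_gt0.
Qed.

Lemma angle_separated d : (0 < d < n.+2)%N ->
  angle L n / 2 <= normc (expi (angle L n) ^+ d - 1).
Proof. exact: expi_separated (angle_gt0 L0 n2) (angle_small L0 n2). Qed.

Definition wide_gaps nu k o x : {set 'I_n} :=
  [set j : 'I_n | 2 * threshold *
      sumabs n (coefpoly x) (center x nu k o) (expi (angle L n))
    < gap (coefpoly x) (normc (center x nu k o)) j].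

Lemma few_free_gaps par nu k o x : ~~ bad_cell par nu k o x ->
  (#|free_pairs par nu k :&: wide_gaps nu k o x| <= npairs n)%N.
Proof.
move=> nb; set D := _ :&: _; rewrite leqNgt; apply: contra nb => hD.
(* [degenerate] asks for exactly [npairs n] pairs, so a larger set is truncated. *)
apply/existsP; exists [set j in take (npairs n) (enum D)]; apply/and3P; split.
- apply/fintype.subsetP => j; rewrite inE => /mem_take; rewrite mem_enum.
  by rewrite /D inE => /andP[].
- rewrite cardsE; apply/eqP.
  have /card_uniqP -> : uniq (take (npairs n) (enum D)) by rewrite take_uniq// enum_uniq.
  by rewrite size_take -cardE hD.
- apply/'forall_implyP => j; rewrite inE => /mem_take; rewrite mem_enum.
  by rewrite /D !inE => /andP[].
Qed.

(** Each parity allows [npairs n] wide gaps, and at most four pairs touch [nu] or [k]. *)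
Lemma few_wide_gaps nu k o x :
  (forall par, ~~ bad_cell par nu k o x) ->
  (#|wide_gaps nu k o x| <= 2 * npairs n + 4)%N.
Proof.
move=> nb; set W := wide_gaps _ _ _ _.
pose D par := free_pairs par nu k :&: W.
pose E (a : nat) (b : bool) := [set j : 'I_n | (b + j)%N == a].
have cE a b : (#|E a b| <= 1)%N.
  apply/card_le1_eqP => i j; rewrite !inE => /eqP hi /eqP hj.
  by apply/val_inj => /=; lia.
apply: (@leq_trans #|(D false :|: D true) :|: ((E nu false :|: E nu true) :|:
    (E k false :|: E k true))|).
  apply/subset_leq_card/fintype.subsetP => j jW.
  rewrite !finset.in_setU /D !finset.in_setI jW !inE !andbT add0n add1n.
  case: (odd j) => /=;
  by case: eqP => //= _; case: eqP => //= _; case: eqP => //= _; case: eqP.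
rewrite (leq_trans (leq_card_setU _ _))// leq_add//.
  rewrite (leq_trans (leq_card_setU _ _))// mul2n -addnn.
  by rewrite leq_add// few_free_gaps.
rewrite (leq_trans (leq_card_setU _ _))// -[4%N]/((1 + 1) + (1 + 1))%N.
by rewrite leq_add// (leq_trans (leq_card_setU _ _))// leq_add.
Qed.

(** This is [coef_le_few_gaps] with [m = 2 * npairs n + 4] and [tau = 2 * threshold * Y]; the
    exponents [m + 2] and [2 * npairs n] of the two losses add up to [4 * npairs n + 6]. *)
Lemma term_le_sumabs nu k o x :
  (forall par, ~~ bad_cell par nu k o x) ->
  forall j, normc (x j) * expR (crossing x nu k + o) ^+ j <=
    n.+1%:R * (2 * n%:R + 8) * (2 / (angle L n / 2)) ^+ (4 * npairs n + 6) *
    sumabs n (coefpoly x) (center x nu k o) (expi (angle L n)).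
Proof.
move=> nb j; have {nb} := few_wide_gaps nb; rewrite /wide_gaps.
set w := center x nu k o; set Y := sumabs n _ _ _ => hcard.
have Y0 : 0 <= Y := sumabs_ge0 _ _ _ _.
set e := 2 / (angle L n / 2).
have e1 : 1 <= e by rewrite ler_pdivlMr// mul1r; have := angle1; lra.
have e0 : 0 <= e by apply: le_trans e1.
have th0 : 0 <= threshold by rewrite exprn_ge0.
have := @coef_le_few_gaps R n x (2 * npairs n + 4) w (expi (angle L n))
  (angle L n / 2) (2 * threshold * Y) eta0 _ _ (normc_expi _) _ angle_separated
  hcard j.
rewrite coef_coefpoly normc_curve -/e -/Y => h.
apply: le_trans (h _ _ _) _.
- by have := angle1; lra.
- by rewrite !mulr_ge0.
- by rewrite -normc_gt0 normc_curve expR_gt0.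
rewrite /threshold -/e.
have k1 : ((2 * npairs n + 4).+2 = 2 * npairs n + 6)%N by rewrite -!addnS.
have k2 : (2 * npairs n + 6 + 2 * npairs n = 4 * npairs n + 6)%N.
  by rewrite addnAC -mulnDl.
have k3 : (2 * npairs n + 6 <= 4 * npairs n + 6)%N by rewrite -k2 leq_addr.
have k4 : (2 * npairs n <= 4 * npairs n + 6)%N by rewrite -k2 leq_addl.
rewrite k1.
set E1 := e ^+ (2 * npairs n); set E2 := e ^+ (4 * npairs n + 6).
set E3 := e ^+ (2 * npairs n + 6).
have E13 : E3 * E1 = E2 by rewrite /E3 /E1 -exprD k2.
have E12 : E1 <= E2 by rewrite /E1 /E2 ler_weXn2l.
have E32 : E3 <= E2 by rewrite /E3 /E2 ler_weXn2l.
rewrite -!mulrA ler_wpM2l//.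
have := ler_wpM2r Y0 E12; have := ler_wpM2r Y0 E32.
have -> : E3 * (2 * Y + n.+2%:R * (2 * (E1 * Y))) + 2 * (E1 * Y) =
  2 * (E3 * Y) + 2 * (n%:R + 2) * ((E3 * E1) * Y) + 2 * (E1 * Y).
  by rewrite -[n.+2]addn2 natrD; ring.
rewrite E13 => h1 h2.
have -> : (2 * n%:R + 8) * (E2 * Y) = 2 * (E2 * Y) + 2 * (n%:R + 2) * (E2 * Y)
   + 2 * (E2 * Y) by ring.
by rewrite !lerD// ler_wpM2l.
Qed.

(** By [cell_zeros], [2 ^+ size zs * Y] is at most a power of [n] times the term [M] of index [nu],
    and by [term_le_sumabs], [M] is at most [exp (O(log^2 n)) * Y]. Dividing by [Y], positive
    because [M] is, and taking binary logarithms gives [O(log^2 n)]. *)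
Lemma cell_bound (a : nat) nu k o x (zs : seq R[i]) q :
  (mesh L)^-1 <= 2 ^+ a ->
  (forall par, ~~ bad_cell par nu k o x) -> x nu != 0 -> `|o| <= 2 ->
  coefpoly x = \prod_(zeta <- zs) ('X - zeta%:P) * q ->
  (forall zeta, zeta \in zs -> exists s,
    [/\ zeta = curve theta s, `|s - (crossing x nu k + o)| <= mesh L * cell_radius n o
      & dominates x nu (crossing x nu k) s]) ->
  (size zs <= (14 + 38 * (7 + a)) * log2n n ^ 2)%N.
Proof.
move=> ha nb xnu o2 xq zsP.
have [->//|zs0] := posnP (size zs).
have := cell_zeros L0 thetaL n2 o2 xq zsP zs0.
rewrite -/(center x nu k o); set Y := sumabs n _ _ _.
have hM := term_le_sumabs nb nu; move: hM; rewrite -/Y.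
set M := normc (x nu) * _ => hM.
have M0 : 0 < M by rewrite mulr_gt0 ?normc_gt0// exprn_gt0// expR_gt0.
set e := 2 / (angle L n / 2) in hM *.
set E := e ^+ _ in hM.
have Y0 : 0 <= Y := sumabs_ge0 _ _ _ _.
have Ygt0 : 0 < Y.
  rewrite lt_def Y0 andbT; apply: contraTneq M0 => Y00.
  by rewrite -leNgt (le_trans hM)// Y00 mulr0.
move=> h.
have {}h : 2 ^+ size zs <= 4 * n.+1%:R * n.+2%:R *
    (n.+1%:R * (2 * n%:R + 8) * E).
  rewrite -(ler_pM2r Ygt0); apply: le_trans h _.
  by rewrite -[leRHS]mulrA ler_wpM2l// !mulr_ge0.
have l0 := log2n_gt0 n2; have ln := leq_log2n n2; set l := log2n n in l0 ln *.
have n1 : (n.+1 <= 2 ^ (2 * l))%N by [].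
have [n2' n8 four hm] := pow2_bounds l0 ln.
have e2 : e <= 2 ^+ ((7 + a) * l).
  have -> : e = 8%:R * n%:R ^+ 2 * (mesh L)^-1.
    rewrite /e /angle; field.
    by rewrite (gt_eqF (mesh_gt0 L0)) pnatr_eq0 -lt0n ltnW.
  rewrite mulnDl exprD; apply: ler_pM.
  - by rewrite mulr_ge0// exprn_ge0.
  - by rewrite invr_ge0 ltW// mesh_gt0.
  - by rewrite -!natrX -natrM ler_nat.
  - by rewrite (le_trans ha)// ler_weXn2l// ?ler1n// leq_pmulr.
have e0 : 0 <= e by rewrite ltW// divr_gt0.
have hE : E <= 2 ^+ ((7 + a) * l * (38 * l)).
  have e1 : 1 <= e by rewrite ler_pdivlMr// mul1r; have := angle1; lra.
  (* The exponent [4 * npairs n + 6] is [32 * l + 6], and [l] is positive. *)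
  apply: (@le_trans _ _ (e ^+ (38 * l))).
    by rewrite ler_weXn2l// /npairs -/l; clear -l0; lia.
  by rewrite [leRHS]exprM; apply: lerXn2r; rewrite ?nnegrE ?exprn_ge0.
have : 2 ^+ size zs <= 2 ^+ (2 * l + 2 * l + 3 * l +
    (2 * l + 5 * l + (7 + a) * l * (38 * l))) :> R.
  have nat_le (u v : nat) : (u <= 2 ^ v)%N -> u%:R <= 2 ^+ v :> R.
    by move=> uv; rewrite -natrX ler_nat.
  have prod6 (u1 u2 u3 u4 u5 u6 v1 v2 v3 v4 v5 v6 : R) :
      0 <= u1 <= v1 -> 0 <= u2 <= v2 -> 0 <= u3 <= v3 ->
      0 <= u4 <= v4 -> 0 <= u5 <= v5 -> 0 <= u6 <= v6 ->
      u1 * u2 * u3 * (u4 * u5 * u6) <= v1 * v2 * v3 * (v4 * v5 * v6).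
    do 6![move=> /andP[? ?]].
    by do ![apply: ler_pM => //; do ?[apply: mulr_ge0 => //]].
  apply: le_trans h _.
  have -> : 2 ^+ (2 * l + 2 * l + 3 * l +
      (2 * l + 5 * l + (7 + a) * l * (38 * l)))
    = 2 ^+ (2 * l) * 2 ^+ (2 * l) * 2 ^+ (3 * l) *
      (2 ^+ (2 * l) * 2 ^+ (5 * l) * 2 ^+ ((7 + a) * l * (38 * l))) :> R.
    by rewrite -!exprD.
  have -> : 2 * n%:R + 8 = (2 * n + 8)%:R :> R by rewrite natrD natrM.
  apply: prod6; rewrite ?ler0n ?nat_le// hE andbT.
  by rewrite /E exprn_ge0.
rewrite -!natrX ler_nat leq_exp2l// => /leq_trans; apply.
exact: exponent_bound.
Qed.

End CellBound.

(** * Covering the zeros by cells *)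

Section Offsets.
Variables (R : realType) (L : R).
Hypothesis L0 : 0 <= L.

Lemma ex_mesh_steps : exists M : nat, (1 - mesh L) ^+ M <= mesh L / 8.
Proof.
have m0 := mesh_gt0 L0; have m1 := mesh_le L0.
(* Bernoulli's inequality then gives [(1 + mesh L) ^+ M >= 8 / mesh L], while
   [(1 - mesh L) * (1 + mesh L) <= 1]. *)
pose M := (Num.trunc (8 / mesh L ^+ 2)).+1.
have hM : 8 / mesh L ^+ 2 < M%:R := truncnS_gt _.
exists M.
have bern k : 1 + k%:R * mesh L <= (1 + mesh L) ^+ k.
  elim: k => [|k IH]; first by rewrite mul0r addr0 expr0.
  rewrite exprS; apply: le_trans (ler_wpM2l _ IH); last by lra.
  rewrite -natr1; have : 0 <= k%:R * mesh L * mesh L by rewrite !mulr_ge0// ltW.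
  by nra.
have h : (1 - mesh L) ^+ M * (1 + mesh L) ^+ M <= 1.
  rewrite -exprMn exprn_ile1//; first by apply: mulr_ge0; lra.
  by nra.
have h8 : 8 / mesh L <= (1 + mesh L) ^+ M.
  apply: le_trans (bern M).
  have -> : 8 / mesh L = 8 / mesh L ^+ 2 * mesh L by field; rewrite gt_eqF.
  by rewrite (le_trans (ler_wpM2r (ltW m0) (ltW hM)))// lerDr.
have p0 : 0 <= (1 - mesh L) ^+ M by rewrite exprn_ge0//; lra.
rewrite -[mesh L / 8]invf_div -div1r ler_pdivlMr ?divr_gt0//.
exact: le_trans (ler_wpM2l p0 h8) h.
Qed.

Lemma geometric_bracket (rho a : R) (I : nat) :
  2 * rho ^+ I < a -> a <= 2 ->
  exists2 i, (i < I)%N & 2 * rho ^+ i.+1 < a <= 2 * rho ^+ i.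
Proof.
move=> + a2; elim: I => [|I IH]; first by rewrite expr0 mulr1 ltNge a2.
move=> h; have [/IH[i iI hi]|hI] := ltP (2 * rho ^+ I) a.
  by exists i => //; exact: ltnW.
by exists I => //; rewrite h hI.
Qed.

(** Geometric progressions from [2] and [-2] towards the breakpoint, [b] being the sign; the last
    index [i = I] is the central cell. *)
Definition offset (I : nat) (i : 'I_I.+1) (b : bool) : R :=
  if (i < I)%N then (-1) ^+ b * (2 * (1 - mesh L) ^+ i) else 0.

Lemma offset_le2 I i b : `|@offset I i b| <= 2.
Proof.
have m0 := mesh_gt0 L0; have m1 := mesh_le L0.
rewrite /offset; case: ifP => _; last by rewrite normr0.
rewrite normrM normr_sign mul1r ger0_norm; last first.
  by rewrite mulr_ge0// exprn_ge0//; lra.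
by rewrite ler_piMr// exprn_ile1//; lra.
Qed.

(** Consecutive offsets [a] and [(1 - mesh L) * a] differ by [mesh L * a], the half-width of the
    cell at [a]. What remains within [mesh L / n] of the breakpoint is the central cell. *)
Lemma offset_cover (n I : nat) (y : R) :
  (0 < n)%N -> 2 * (1 - mesh L) ^+ I <= mesh L / n%:R -> `|y| <= 2 ->
  exists i b, `|y - @offset I i b| <= mesh L * cell_radius n (offset i b).
Proof.
have m0 := mesh_gt0 L0; have m1 := mesh_le L0.
move=> n0 hI y2; have [hy|hy] := leP `|y| (mesh L / n%:R).
  exists ord_max, false; rewrite /offset ltnn subr0 (le_trans hy)//.
  by rewrite ler_wpM2l ?(ltW m0)// /cell_radius le_max lexx orbT.
have [i iI /andP[h1 h2]] := geometric_bracket (le_lt_trans hI hy) y2.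
have iI1 : (i < I.+1)%N by exact: ltnW.
exists (Ordinal iI1), (y < 0); rewrite /offset /= iI.
set a := 2 * _ in h2 *.
have a0 : 0 <= a by rewrite mulr_ge0// exprn_ge0//; lra.
have ha : a - `|y| <= mesh L * a.
  by move: h1; rewrite exprSr mulrA -/a; lra.
have -> : y - (-1) ^+ (y < 0)%R * a = (-1) ^+ (y < 0)%R * (`|y| - a).
  by rewrite mulrBr -numEsign.
rewrite normrM normr_sign mul1r distrC ger0_norm ?subr_ge0// (le_trans ha)//.
rewrite ler_wpM2l ?(ltW m0)// /cell_radius le_max normrM normr_sign mul1r.
by rewrite ger0_norm// lexx.
Qed.

(** Each block of [M] steps gains a factor 8, and [2 * n <= 8 ^ log2n n]; hence [O(log n)] cells
    suffice. *)
Lemma steps_fine (M n : nat) : (2 <= n)%N -> (1 - mesh L) ^+ M <= mesh L / 8 ->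
  2 * (1 - mesh L) ^+ (M * log2n n) <= mesh L / n%:R.
Proof.
have m0 := mesh_gt0 L0; have m1 := mesh_le L0.
move=> n2 hM; have l0 := log2n_gt0 n2.
have p0 : 0 <= (1 - mesh L) ^+ M by rewrite exprn_ge0//; lra.
rewrite exprM; set l := log2n n in l0 *.
apply: (@le_trans _ _ (2 * (mesh L * 8 ^- l))).
  rewrite ler_wpM2l//; apply: (@le_trans _ _ ((mesh L / 8) ^+ l)).
    by apply: lerXn2r; rewrite ?nnegrE// ltW// divr_gt0.
  rewrite expr_div_n ler_wpM2r ?invr_ge0 ?exprn_ge0//.
  by rewrite -[leRHS]expr1 ler_wiXn2l ?(ltW m0)//; lra.
rewrite mulrCA ler_wpM2l ?(ltW m0)// ler_pdivrMr ?exprn_gt0//.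
rewrite mulrC ler_pdivlMr ?ltr0n 1?ltnW// -natrM -natrX ler_nat.
have hn : (n < 2 ^ l.+1)%N := trunc_log_ltn n (ltnSn 1).
apply: (@leq_trans (2 * 2 ^ l.+1)); first by rewrite leq_mul// ltnW.
rewrite -expnS (_ : 8 = 2 ^ 3)%N// -expnM leq_exp2l//.
by move: l0; clear; lia.
Qed.

End Offsets.

(** * Absence of zeros far from the breakpoints *)

Section FarZeros.
Variables (R : realType) (n : nat).
Implicit Types (x : 'I_n.+1 -> R[i]) (nu : 'I_n.+1).

Lemma sum_quarter m : \sum_(0 <= i < m) (1 / 4 : R) ^+ i.+1 <= 1 / 3.
Proof.
suff -> : \sum_(0 <= i < m) (1 / 4 : R) ^+ i.+1 = (1 - (1 / 4) ^+ m) / 3.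
  by have : 0 <= (1 / 4 : R) ^+ m by []; lra.
elim: m => [|m IH]; first by rewrite big_geq// expr0 subrr mul0r.
by rewrite big_nat_recr//= IH exprSr; field.
Qed.

(** Since [exp (- 2) <= 1 / 4], the terms on each side of [nu] add up to at most a third of the
    dominant one, so they cannot cancel it. *)
Lemma no_far_zero x nu b s (z : R[i]) : x nu != 0 -> dominates x nu b s ->
  2 < `|s - b| -> normc z = expR s -> ~~ root (coefpoly x) z.
Proof.
move=> xnu dom far zs; apply/negP => /rootP p0.
set M := normc (x nu) * expR s ^+ nu.
have M0 : 0 < M by rewrite mulr_gt0 ?normc_gt0 ?exprn_gt0 ?expR_gt0.
have e4 : expR (- `|s - b|) <= 1 / 4.
  rewrite expRN div1r lef_pV2 ?posrE ?expR_gt0//.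
  apply: (@le_trans _ _ (expR 2)); last by rewrite ler_expR ltW.
  have h : 2 <= expR 1 :> R by have := @expR_ge1Dx R 1; lra.
  have -> : 4 = 2 * 2 :> R by lra.
  have -> : 2 = 1 + 1 :> R by lra.
  by rewrite expRD ler_pM//; lra.
have domE (j : 'I_n.+1) (d : nat) : `|j%:R - nu%:R| = d%:R :> R ->
    normc (x j) * expR s ^+ j <= M * (1 / 4) ^+ d.
  move=> jd; have := dom j; rewrite jd expRM_natl => /le_trans; apply.
  rewrite expRD expRM_natl mulrA -/M ler_wpM2l ?(ltW M0)//.
  rewrite -mulrN expRM_natl.
  by apply: lerXn2r => //; rewrite nnegrE ?expR_ge0.
have : M <= \sum_(j < n.+1 | j != nu) normc (x j) * expR s ^+ j.
  have : \sum_(j < n.+1) x j * z ^+ j = 0.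
    transitivity (coefpoly x).[z] => //.
    rewrite (horner_coef_wide _ (size_coefpoly x)).
    by apply: eq_bigr => j _; rewrite coef_coefpoly.
  rewrite (bigD1 nu)//= => /eqP; rewrite addr_eq0 => /eqP h.
  have : normc (x nu * z ^+ nu) = M by rewrite normcM normcX zs.
  rewrite h normc_opp => <-; apply: (le_trans (ler_normc_sum _ _ _)).
  by apply: ler_sum => j _; rewrite normcM normcX zs.
pose F (j : nat) : R := if j == nu then 0 else
  normc (coefpoly x)`_j * expR s ^+ j.
have -> : \sum_(j < n.+1 | j != nu) normc (x j) * expR s ^+ j
    = \sum_(0 <= j < n.+1) F j.
  rewrite big_mkord big_mkcond/=; apply: eq_bigr => j _.
  rewrite /F coef_coefpoly -val_eqE /=; by case: eqP.
have nun : (nu <= n.+1)%N by exact: ltnW.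
rewrite (@big_cat_nat _ _ _ nu)//=.
have h1 : \sum_(0 <= j < nu) F j <= M * (1 / 3).
  rewrite big_nat_rev /= add0n; apply: le_trans (ler_wpM2l (ltW M0) (sum_quarter nu)).
  rewrite mulr_sumr; apply: ler_sum_nat => i /andP[_ inu].
  have jN : (nu - i.+1 < n.+1)%N by rewrite (leq_ltn_trans (leq_subr _ _)).
  rewrite /F ltn_eqF; last by rewrite ltn_subrL (leq_ltn_trans _ inu).
  rewrite -[(nu - i.+1)%N]/(nat_of_ord (Ordinal jN)) coef_coefpoly.
  apply: domE => /=; rewrite natrB// distrC opprB addrC subrK ger0_norm//.
have h2 : \sum_(nu <= j < n.+1) F j <= M * (1 / 3).
  rewrite big_ltn// {1}/F eqxx add0r.
  apply: le_trans (ler_wpM2l (ltW M0) (sum_quarter (n.+1 - nu.+1))).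
  rewrite -[in X in \sum_(X <= _ < _) _](add0n nu.+1) big_addn mulr_sumr.
  apply: ler_sum_nat => i /andP[_ inu].
  have jN : (i + nu.+1 < n.+1)%N by move: inu; rewrite ltn_subRL addnC.
  rewrite /F gtn_eqF; last by rewrite addnS ltnS leq_addl.
  rewrite -[(i + nu.+1)%N]/(nat_of_ord (Ordinal jN)) coef_coefpoly.
  apply: domE => /=; rewrite -addSnnS natrD addrK ger0_norm//.
move=> h; have := le_trans h (lerD h1 h2); lra.
Qed.

End FarZeros.

(** * Records and breakpoints attached to a radius *)

Section Assignment.
Variables (R : realType) (n : nat).
Implicit Types (x : 'I_n.+1 -> R[i]) (nu k : 'I_n.+1).

Definition left_record x nu : bool :=
  [forall j : 'I_n.+1, (j < nu)%N ==> (normc (x j) < normc (x nu))].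

Definition right_record x nu : bool :=
  [forall j : 'I_n.+1, (nu < j)%N ==> (normc (x j) < normc (x nu))].

(* The index of the term that overtakes [nu] first when the radius increases
   ([up]) or decreases; meaningful only if there is such a term. *)
Definition neighbour x nu (up : bool) : 'I_n.+1 :=
  if up then [arg min_(k < ord_max | (nu < k)%N && (x k != 0)) crossing x nu k]%O
  else [arg max_(k > ord0 | (k < nu)%N && (x k != 0)) crossing x nu k]%O.

(** The logarithm of the ratio of the two terms is affine in [s] with slope [k - nu], and vanishes
    at the crossing. *)
Lemma term_crossing x nu k (s : R) : x nu != 0 -> x k != 0 -> k != nu ->
  normc (x k) * expR (k%:R * s) = normc (x nu) *
    expR (nu%:R * s + (k%:R - nu%:R) * (s - crossing x nu k)).
Proof.
move=> xnu xk knu.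
have kn : k%:R - nu%:R != 0 :> R by rewrite subr_eq0 eqr_nat.
have e j : x j != 0 -> normc (x j) = expR (ln (normc (x j))).
  by move=> xj; rewrite lnK// posrE normc_gt0.
rewrite [in LHS]e// [X in _ = X * _]e// -!expRD; congr expR.
by rewrite mulrBr /crossing mulrC [X in _ - X]mulrC divfK//; ring.
Qed.

(** Among the indices of maximal terms take the smallest if [s <= 0], the largest otherwise. The
    terms on the corresponding side are strictly smaller although their exponential factors are at
    least as large, so their coefficients are strictly smaller. *)
Lemma exists_dominant_record x (s : R) : x ord0 != 0 ->
  exists nu, [/\ left_record x nu || right_record x nu, x nu != 0 &
    forall j, normc (x j) * expR (j%:R * s) <= normc (x nu) * expR (nu%:R * s)].
Proof.
move=> x0; pose a (j : 'I_n.+1) := normc (x j) * expR (j%:R * s).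
have [m _ mmax] := @Order.TotalTheory.arg_maxP _ _ _ ord0 xpredT a isT.
pose Q := [pred j | a j == a m].
have Qm : Q m by rewrite /= eqxx.
have a0 : 0 < a ord0 by rewrite mulr_gt0 ?normc_gt0 ?expR_gt0.
have am : 0 < a m by exact: lt_le_trans a0 (mmax ord0 isT).
have aQ nu : Q nu -> x nu != 0 /\ (forall j, a j <= a nu).
  move=> /eqP aE; split; last by move=> j; rewrite aE; exact: mmax.
  by apply: contraTneq am => xnu; rewrite -aE /a xnu normc_zero mul0r ltxx.
have [s0|/ltW s0] := leP s 0.
- case: (arg_minnP (fun j : 'I_n.+1 => j : nat) Qm) => nu Qnu numin.
  have [xnu hnu] := aQ _ Qnu; exists nu; split => //.
  apply/orP; left; apply/forallP => j; apply/implyP => jnu.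
  have : a j < a nu.
    rewrite lt_neqAle hnu andbT; apply: contraTneq jnu => ajnu.
    by rewrite -leqNgt numin//= ajnu.
  rewrite /a -ltr_pdivlMr ?expR_gt0// => /lt_le_trans; apply.
  rewrite -mulrA ler_piMr ?normc_ge0// -expRN -expRD -[leRHS]expR0 ler_expR.
  rewrite -mulrBl mulr_ge0_le0// subr_ge0 ler_nat; exact: ltnW.
- case: (arg_maxnP (fun j : 'I_n.+1 => j : nat) Qm) => nu Qnu numax.
  have [xnu hnu] := aQ _ Qnu; exists nu; split => //.
  apply/orP; right; apply/forallP => j; apply/implyP => jnu.
  have : a j < a nu.
    rewrite lt_neqAle hnu andbT; apply: contraTneq jnu => ajnu.
    by rewrite -leqNgt; apply: numax; rewrite /= ajnu.
  rewrite /a -ltr_pdivlMr ?expR_gt0// => /lt_le_trans; apply.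
  rewrite -mulrA ler_piMr ?normc_ge0// -expRN -expRD -[leRHS]expR0 ler_expR.
  rewrite -mulrBl mulr_le0_ge0// subr_le0 ler_nat; exact: ltnW.
Qed.

(** As [nu] is maximal at [s], its crossings with higher indices lie to the right of [s] and those
    with lower indices to the left. Term [j] decays at rate [|j - nu|] times the distance to its own
    crossing, which is at least the distance to the nearest one, a neighbour of [nu]. *)
Lemma exists_dominating_cell x (s : R) :
  (0 < n)%N -> x ord0 != 0 -> x ord_max != 0 ->
  exists nu up, [/\ left_record x nu || right_record x nu, x nu != 0 &
    dominates x nu (crossing x nu (neighbour x nu up)) s].
Proof.
move=> n0 x0 xn; have [nu [rec xnu hnu]] := exists_dominant_record s x0.
have sgn k : k != nu -> x k != 0 -> (k%:R - nu%:R) * (s - crossing x nu k) <= 0.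
  move=> knu xk; have := hnu k; rewrite (@term_crossing x nu)// ler_pM2l ?normc_gt0//.
  by rewrite ler_expR gerDl.
have hi k : (nu < k)%N -> x k != 0 -> s <= crossing x nu k.
  move=> nuk xk; have := sgn k _ xk; rewrite -val_eqE gtn_eqF// => /(_ isT).
  by rewrite pmulr_rle0 ?subr_le0// subr_gt0 ltr_nat.
have lo k : (k < nu)%N -> x k != 0 -> crossing x nu k <= s.
  move=> nuk xk; have := sgn k _ xk; rewrite -val_eqE ltn_eqF// => /(_ isT).
  by rewrite nmulr_rle0 ?subr_ge0// subr_lt0 ltr_nat.
exists nu.
suff [up hup] : exists up, forall k, k != nu -> x k != 0 ->
    `|s - crossing x nu (neighbour x nu up)| <= `|s - crossing x nu k|.
  exists up; split => // j; set D := `|_ - crossing _ _ _| in hup *.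
  have [->|jnu] := eqVneq j nu; first by rewrite subrr normr0 mul0r subr0.
  have [xj|xj] := eqVneq (x j) 0.
    by rewrite xj normc_zero mul0r mulr_ge0 ?normc_ge0 ?expR_ge0.
  rewrite (@term_crossing x nu)// ler_wpM2l ?normc_ge0// ler_expR lerD2l.
  have := sgn j jnu xj; rewrite -oppr_ge0 => /ger0_norm.
  rewrite normrN normrM => h.
  rewrite -[leLHS]opprK -h lerN2 ler_wpM2l//; exact: hup.
have up_ok : (nu < n)%N -> [/\ (nu < neighbour x nu true)%N,
    x (neighbour x nu true) != 0 & forall k, (nu < k)%N -> x k != 0 ->
      `|s - crossing x nu (neighbour x nu true)| <= `|s - crossing x nu k|].
  move=> nun; rewrite /neighbour; case: Order.TotalTheory.arg_minP => [|k].
    by rewrite /= nun.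
  move=> /andP[nuk xk] kmin; split => // j nuj xj.
  rewrite !ler0_norm ?subr_le0 ?hi// lerN2 lerD2l lerN2.
  by apply: kmin; rewrite nuj.
have lo_ok : (0 < nu)%N -> [/\ (neighbour x nu false < nu)%N,
    x (neighbour x nu false) != 0 & forall k, (k < nu)%N -> x k != 0 ->
      `|s - crossing x nu (neighbour x nu false)| <= `|s - crossing x nu k|].
  move=> nun; rewrite /neighbour; case: Order.TotalTheory.arg_maxP => [|k].
    by rewrite /= nun.
  move=> /andP[nuk xk] kmin; split => // j nuj xj.
  rewrite !ger0_norm ?subr_ge0 ?lo// lerD2l lerN2.
  by apply: kmin; rewrite nuj.
(* At an end index only one side has terms; elsewhere the nearer neighbour is taken, and both exist
   because the end coefficients are nonzero. *)
have [nu0|nu0] := posnP nu.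
  exists true => k knu xk; have [|_ _] := up_ok; first by rewrite nu0.
  by apply => //; rewrite ltn_neqAle eq_sym -[(k : nat) == nu]/(k == nu) knu nu0.
have [nun|nun] := ltnP nu n; last first.
  exists false => k knu xk; have [//|_ _] := lo_ok.
  apply => //; rewrite ltn_neqAle -[(k : nat) == nu]/(k == nu) knu /=.
  by rewrite (leq_trans _ nun)// -ltnS ltn_ord.
have [_ _ h1] := up_ok nun; have [_ _ h2] := lo_ok nu0.
set d1 := `|_| in h1; set d2 := `|_| in h2.
have [d12|/ltW d12] := leP d1 d2.
- exists true => k; rewrite -val_eqE neq_ltn => /orP[] kn xk.
    by apply: le_trans d12 _; exact: h2.
  exact: h1.
- exists false => k; rewrite -val_eqE neq_ltn => /orP[] kn xk.
    exact: h2.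
  by apply: le_trans d12 _; exact: h1.
Qed.

End Assignment.

(** * Counting zeros over all cells *)

Section TotalZeros.
Variables (R : realType) (L : R) (theta : R -> R).
Hypothesis L0 : 0 <= L.
Hypothesis thetaL : forall r1 r2 : R, 0 < r1 -> 0 < r2 ->
  `|theta r1 - theta r2| <= L * `|ln (r1 / r2)|.
Variable n : nat.
Hypothesis n2 : (2 <= n)%N.
Implicit Types (x : 'I_n.+1 -> R[i]) (nu k : 'I_n.+1).

Lemma polar_curveE (z : R[i]) : polar_curve theta z -> z != 0 ->
  exists s, z = curve theta s.
Proof.
move=> [r r0 ->] z0; have {}r0 : 0 < r.
  rewrite lt_def r0 andbT; apply: contraNneq z0 => ->.
  by rewrite !mul0r.
exists (ln r); rewrite /curve lnK ?posrE// /expi.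
by apply/eqP; rewrite eq_complex /= !mul0r subr0 addr0 !eqxx.
Qed.

(** Every zero on the curve lies in a cell [(nu, up, i, b)] with [nu] a record, and each record has
    [4 * (M * log2n n).+1] cells. Multiplicities are accounted for since [rs] lists the roots with
    repetition. *)
Lemma total_zeros (a M : nat) x c (rs : seq R[i]) :
  (mesh L)^-1 <= 2 ^+ a -> (1 - mesh L) ^+ M <= mesh L / 8 ->
  x ord0 != 0 -> x ord_max != 0 ->
  (forall par nu k i b, ~~ bad_cell L theta par nu k
      (@offset R L (M * log2n n) i b) x) ->
  coefpoly x = c *: \prod_(z <- rs) ('X - z%:P) ->
  (count (fun z => z \in polar_curve theta) rs <=
   \sum_(nu < n.+1) (left_record x nu || right_record x nu) *
     (4 * (M * log2n n).+1 * ((14 + 38 * (7 + a)) * log2n n ^ 2)))%N.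
Proof.
move=> ha hM x0 xn good xrs; set I := (M * log2n n)%N in good *.
set D := ((14 + 38 * (7 + a)) * log2n n ^ 2)%N.
have n0 : (0 < n)%N by exact: ltnW.
have rs_root z : z \in rs -> root (coefpoly x) z.
  by move=> zrs; apply/rootP; rewrite xrs hornerZ (rootP _) ?mulr0// root_prod_XsubC.
set zs := [seq z <- rs | z \in polar_curve theta].
pose cell nu up (i : 'I_I.+1) b (z : R[i]) :=
  [&& left_record x nu || right_record x nu, x nu != 0 & `[<exists s,
    [/\ z = curve theta s,
       `|s - (crossing x nu (neighbour x nu up) + offset L i b)|
         <= mesh L * cell_radius n (offset L i b)
     & dominates x nu (crossing x nu (neighbour x nu up)) s]>]].
have cover z : z \in zs -> exists nu up i b, cell nu up i b z.
  rewrite mem_filter => /andP[/set_mem zG zrs].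
  (* The origin lies on the curve but has no log-radius; it is not a root because [x ord0] is
     nonzero. *)
  have z0 : z != 0.
    apply: contraNneq x0 => z0; have := rs_root _ zrs; rewrite z0 /root.
    by rewrite horner_coef0 -[0%N]/(nat_of_ord (@ord0 n)) coef_coefpoly.
  have [s zs_] := polar_curveE zG z0.
  have [nu [up [rec xnu dom]]] := exists_dominating_cell s n0 x0 xn.
  have near : `|s - crossing x nu (neighbour x nu up)| <= 2.
    rewrite leNgt; apply/negP => far.
    have := no_far_zero (z := z) xnu dom far; rewrite zs_ normc_curve => /(_ erefl).
    by rewrite -zs_ rs_root.
  have [i [b hib]] := offset_cover L0 n0 (steps_fine L0 n2 hM) near.
  exists nu, up, i, b; rewrite /cell rec xnu /=; apply/asboolP; exists s.
  by split => //; rewrite opprD addrA.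
have cell_le nu up i b :
    (count (cell nu up i b) zs <= (left_record x nu || right_record x nu) * D)%N.
  case rec : (left_record x nu || right_record x nu); last first.
    rewrite (eq_count (a2 := pred0)) ?count_pred0// => z.
    by rewrite /cell rec.
  rewrite mul1n; have [->//|] := posnP (count (cell nu up i b) zs).
  rewrite -has_count => /hasP[z0 _ /and3P[_ xnu _]]; rewrite -size_filter.
  pose P z := cell nu up i b z && (z \in polar_curve theta).
  apply: (@cell_bound R L theta L0 thetaL n n2 a nu (neighbour x nu up)
    (offset L i b) x _ (c *: \prod_(z <- rs | ~~ P z) ('X - z%:P))) => //.
  - exact: offset_le2.
  - rewrite xrs -scalerAr; congr (_ *: _).
    by rewrite /zs -filter_predI big_filter (bigID P).
  - move=> z; rewrite mem_filter => /andP[/and3P[_ _ /asboolP]] //.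
have sum_cell nu up i b :
    (\sum_(z <- zs) cell nu up i b z
     <= (left_record x nu || right_record x nu) * D)%N.
  apply: leq_trans (cell_le nu up i b); rewrite -sum1_count [leqRHS]big_mkcond.
  by apply: leq_sum => z _; case: (cell _ _ _ _ _).
rewrite -size_filter -/zs -sum1_size.
apply: (@leq_trans (\sum_(z <- zs) \sum_(nu < n.+1) \sum_(up : bool)
    \sum_(i < I.+1) \sum_(b : bool) cell nu up i b z)).
  rewrite big_seq [X in (_ <= X)%N]big_seq; apply: leq_sum => z /cover.
  move=> [nu [up [i [b hc]]]].
  rewrite (bigD1 nu)//= (bigD1 up)//= (bigD1 i)//= (bigD1 b)//= hc.
  by rewrite -!addnA.
rewrite exchange_big/=; apply: leq_sum => nu _.
rewrite exchange_big/= big_bool /=.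
apply: (@leq_trans (\sum_(up : bool) \sum_(i < I.+1) \sum_(b : bool)
   (left_record x nu || right_record x nu) * D)); last first.
  by rewrite !sum_nat_const !card_bool card_ord; lia.
rewrite big_bool /= leq_add//; rewrite exchange_big/=; apply: leq_sum => i _;
  rewrite exchange_big/=; apply: leq_sum => b _.
  by rewrite sum_cell.
by rewrite sum_cell.
Qed.

End TotalZeros.

Local Open Scope classical_set_scope.
Local Open Scope ring_scope.
Local Open Scope complex_scope.

(** * Measurability *)

Section Measurability.
Context d (T : measurableType d) (R : realType).
Implicit Types (f g : T -> R) (u v : T -> R[i]).

Lemma measurable_complex_pair : measurable_fun [set: R[i]] (@complex_pair R).
Proof. by move=> _ A mA; rewrite setTI; exists A => //; rewrite setTI. Qed.

Lemma measurable_Re : measurable_fun [set: R[i]] (@complex.Re R).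
Proof. exact: (measurableT_comp measurable_fst measurable_complex_pair). Qed.

Lemma measurable_Im : measurable_fun [set: R[i]] (@complex.Im R).
Proof. exact: (measurableT_comp measurable_snd measurable_complex_pair). Qed.

Definition cmeasurable u :=
  measurable_fun [set: T] (@complex.Re R \o u) /\
  measurable_fun [set: T] (@complex.Im R \o u).

Lemma cmeasurable_comp u : measurable_fun [set: T] u -> cmeasurable u.
Proof.
move=> mu; split; apply: measurableT_comp => //.
  exact: measurable_Re.
exact: measurable_Im.
Qed.

Lemma cmeasurable_cst z : cmeasurable (fun _ => z).
Proof. by split; exact: measurable_cst. Qed.

Lemma cmeasurableD u v : cmeasurable u -> cmeasurable v ->
  cmeasurable (fun x => u x + v x).
Proof.
move=> [u1 u2] [v1 v2]; split.
- rewrite (_ : _ \o _ = (@complex.Re R \o u) \+ (@complex.Re R \o v)).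
    exact: measurable_funD.
  by apply/funext => x /=; case: (u x) => ? ?; case: (v x).
- rewrite (_ : _ \o _ = (@complex.Im R \o u) \+ (@complex.Im R \o v)).
    exact: measurable_funD.
  by apply/funext => x /=; case: (u x) => ? ?; case: (v x).
Qed.

Lemma cmeasurableM u v : cmeasurable u -> cmeasurable v ->
  cmeasurable (fun x => u x * v x).
Proof.
move=> [u1 u2] [v1 v2]; split.
- rewrite (_ : _ \o _ = ((@complex.Re R \o u) \* (@complex.Re R \o v)) \-
    ((@complex.Im R \o u) \* (@complex.Im R \o v))).
    by apply: measurable_funB; exact: measurable_funM.
  by apply/funext => x /=; case: (u x) => ? ?; case: (v x).
- rewrite (_ : _ \o _ = ((@complex.Re R \o u) \* (@complex.Im R \o v)) \+
    ((@complex.Im R \o u) \* (@complex.Re R \o v))).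
    by apply: measurable_funD; exact: measurable_funM.
  by apply/funext => x /=; case: (u x) => ? ?; case: (v x).
Qed.

Lemma cmeasurableB u v : cmeasurable u -> cmeasurable v ->
  cmeasurable (fun x => u x - v x).
Proof.
move=> mu mv; rewrite (_ : (fun x => _) = (fun x => u x + (-1) * v x)).
  by apply: cmeasurableD => //; apply: cmeasurableM => //; exact: cmeasurable_cst.
by apply/funext => x; rewrite mulN1r.
Qed.

Lemma cmeasurable_sum (I : Type) (s : seq I) (u : I -> T -> R[i]) :
  (forall i, cmeasurable (u i)) -> cmeasurable (fun x => \sum_(i <- s) u i x).
Proof.
move=> mu; elim: s => [|i s IH].
  rewrite (_ : (fun x => _) = (fun=> 0)); first exact: cmeasurable_cst.
  by apply/funext => x; rewrite big_nil.
rewrite (_ : (fun x => _) = (fun x => u i x + \sum_(i <- s) u i x)).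
  exact: cmeasurableD.
by apply/funext => x; rewrite big_cons.
Qed.

Lemma cmeasurableX u k : cmeasurable u -> cmeasurable (fun x => u x ^+ k).
Proof.
move=> mu; elim: k => [|k IH].
  rewrite (_ : (fun x => _) = (fun=> 1)); first exact: cmeasurable_cst.
  by apply/funext => x; rewrite expr0.
rewrite (_ : (fun x => _) = (fun x => u x * u x ^+ k)); first exact: cmeasurableM.
by apply/funext => x; rewrite exprS.
Qed.

Lemma measurable_normc u : cmeasurable u ->
  measurable_fun [set: T] (fun x => normc (u x)).
Proof.
move=> [mre mim]; rewrite (_ : (fun x => _) =
  @Num.sqrt R \o (fun x => (@complex.Re R \o u) x ^+ 2 + (@complex.Im R \o u) x ^+ 2)).
  apply: measurableT_comp.
    by apply: continuous_measurable_fun; exact: sqrt_continuous.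
  by apply: measurable_funD; exact: measurable_funX.
by apply/funext => x /=; case: (u x).
Qed.

Lemma measurable_forall (I : finType) (b : I -> T -> bool) :
  (forall i, measurable [set x | b i x]) -> measurable [set x | [forall i, b i x]].
Proof.
move=> mb; rewrite (_ : [set x | _] = \bigcap_(i in [set: I]) [set x | b i x]).
  exact: fin_bigcap_measurable.
apply/seteqP; split => x /= => [/forallP h i _|h]; first exact: h.
by apply/forallP => i; exact: h.
Qed.

Lemma measurable_exists (I : finType) (b : I -> T -> bool) :
  (forall i, measurable [set x | b i x]) -> measurable [set x | [exists i, b i x]].
Proof.
move=> mb; rewrite (_ : [set x | _] = \bigcup_(i in [set: I]) [set x | b i x]).
  exact: fin_bigcup_measurable.
apply/seteqP; split => x /= => [/existsP[i h]|[i _ h]]; first by exists i.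
by apply/existsP; exists i.
Qed.

Lemma measurable_imply (c : bool) (b : T -> bool) :
  measurable [set x | b x] -> measurable [set x | c ==> b x].
Proof.
case: c => //= _; rewrite (_ : [set x | _] = setT)//.
exact/seteqP.
Qed.

Lemma measurable_andb (c : bool) (b : T -> bool) :
  measurable [set x | b x] -> measurable [set x | c && b x].
Proof.
case: c => //= _; rewrite (_ : [set x | _] = set0)//.
by apply/seteqP; split => x /=.
Qed.

Lemma measurable_ltr f g : measurable_fun [set: T] f -> measurable_fun [set: T] g ->
  measurable [set x | f x < g x].
Proof.
move=> mf mg; have := measurable_fun_ltr mf mg measurableT (Y := [set true]) I.
rewrite setTI; congr measurable; apply/seteqP; split => x //=.
Qed.

End Measurability.

(** * Measurability of records and bad cells *)

Section MeasurableEvents.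
Variables (R : realType) (n : nat).
Local Notation E := (n.+1.-tuple R[i]).
Implicit Types (nu k : 'I_n.+1).

Lemma cmeasurable_tnth k : cmeasurable (fun x : E => tnth x k).
Proof. by apply: cmeasurable_comp; exact: measurable_tnth. Qed.

Lemma measurable_normc_tnth k :
  measurable_fun [set: E] (fun x : E => normc (tnth x k)).
Proof. by apply: measurable_normc; exact: cmeasurable_tnth. Qed.

Lemma measurable_left_record nu :
  measurable [set x : E | left_record (tnth x) nu].
Proof.
apply: measurable_forall => j; apply: measurable_imply.
by apply: measurable_ltr; exact: measurable_normc_tnth.
Qed.

Lemma measurable_right_record nu :
  measurable [set x : E | right_record (tnth x) nu].
Proof.
apply: measurable_forall => j; apply: measurable_imply.
by apply: measurable_ltr; exact: measurable_normc_tnth.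
Qed.

Variables (L : R) (theta : R -> R).
Hypothesis L0 : 0 <= L.
Hypothesis thetaL : forall r1 r2 : R, 0 < r1 -> 0 < r2 ->
  `|theta r1 - theta r2| <= L * `|ln (r1 / r2)|.

(** The hypothesis constrains [theta] only at positive radii, hence the composition with [expR]. The
    constant [L + 1] replaces [L], which may be zero, as a divisor. *)
Lemma measurable_theta : measurable_fun [set: R] (theta \o expR).
Proof.
have L1 : 0 < L + 1 by have := L0; lra.
apply: continuous_measurable_fun => s; apply/cvgrPdist_le => e e0.
near=> t; rewrite (le_trans (theta_lipschitz thetaL _ _))//.
apply: (@le_trans _ _ ((L + 1) * `|s - t|)).
  by rewrite ler_wpM2r//; lra.
rewrite mulrC -ler_pdivlMr//.
near: t; apply/nbhs_ballP; exists (e / (L + 1)) => /=; first exact: divr_gt0.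
by move=> t; rewrite /ball /= => /ltW.
Unshelve. all: by end_near. Qed.

Lemma measurable_crossing nu k :
  measurable_fun [set: E] (fun x : E => crossing (tnth x) nu k).
Proof.
apply: measurable_funM; last exact: measurable_cst.
by apply: measurable_funB; apply: (measurableT_comp (@measurable_ln R));
  exact: measurable_normc_tnth.
Qed.

Lemma cmeasurable_center nu k o :
  cmeasurable (fun x : E => center theta (tnth x) nu k o).
Proof.
have ms : measurable_fun [set: E] (fun x : E => crossing (tnth x) nu k + o).
  by apply: measurable_funD; [exact: measurable_crossing|exact: measurable_cst].
have mth := measurableT_comp measurable_theta ms.
apply: cmeasurableM; split.
- exact: (measurableT_comp (@measurable_expR R) ms).
- exact: measurable_cst.
- exact: (measurableT_comp (continuous_measurable_fun (@continuous_cos R)) mth).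
- exact: (measurableT_comp (continuous_measurable_fun (@continuous_sin R)) mth).
Qed.

Lemma measurable_bad_cell par nu k o :
  measurable [set x : E | bad_cell L theta par nu k o (tnth x)].
Proof.
apply: measurable_exists => S; apply: measurable_andb; apply: measurable_andb.
apply: measurable_forall => j; apply: measurable_imply.
have mw := cmeasurable_center nu k o.
apply: measurable_ltr.
  apply: measurable_funM; first exact: measurable_cst.
  apply: measurable_sum => l; apply: measurable_normc.
  rewrite (_ : (fun x => _) = (fun x : E => \sum_(i < n.+1) tnth x i *
    (center theta (tnth x) nu k o * expi (angle L n) ^+ l) ^+ i)).
    apply: cmeasurable_sum => i; apply: cmeasurableM; first exact: cmeasurable_tnth.
    by apply: cmeasurableX; apply: cmeasurableM => //; exact: cmeasurable_cst.
  apply/funext => x; rewrite (horner_coef_wide _ (size_coefpoly _)).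
  by apply: eq_bigr => i _; rewrite coef_coefpoly.
rewrite (_ : (fun x => _) = (fun x : E =>
    normc (tnth x (inord j) - tnth x (inord j.+1)) *
    Num.max (normc (center theta (tnth x) nu k o) ^+ j)
            (normc (center theta (tnth x) nu k o) ^+ j.+1))).
  apply: measurable_funM.
    by apply: measurable_normc; apply: cmeasurableB; exact: cmeasurable_tnth.
  by apply: measurable_maxr; apply: measurable_funX; exact: measurable_normc.
apply/funext => x; rewrite /gap !coef_coefpoly_nat//.
exact: ltnW.
Qed.

End MeasurableEvents.

(** * Exchangeability *)

Section Exchangeability.
Context d (T : measurableType d) (R : realType) (P : probability T R) (n : nat).
Variable lambda : 'I_n.+1 -> {RV P >-> R[i]}.
Local Notation E := (n.+1.-tuple R[i]).
Implicit Types (s : 'I_n.+1 -> 'I_n.+1) (A : set E).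

Definition coefs s (w : T) : E := [tuple lambda (s i) w | i < n.+1].

Lemma measurable_coefs s : measurable_fun [set: T] (coefs s).
Proof.
apply/measurable_fun_tnthP => i.
rewrite (_ : _ \o _ = lambda (s i)); first exact: measurable_funPT.
by apply/funext => w /=; rewrite tnth_mktuple.
Qed.

Lemma measurable_preimage_coefs s A : measurable A -> measurable (coefs s @^-1` A).
Proof. by move=> mA; rewrite -[_ @^-1` _]setTI; exact: measurable_coefs. Qed.

Definition boxes : set (set E) :=
  [set A | exists2 B : 'I_n.+1 -> set R[i], (forall i, measurable (B i)) &
    A = \bigcap_(i in [set: 'I_n.+1]) [set x | B i (tnth x i)]].

Lemma measurable_boxes : @measurable _ E = <<s boxes >>.
Proof.
apply/seteqP; split.
- apply: smallest_sub; first exact: smallest_sigma_algebra.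
  rewrite -bigcup_seq/= => _ [i _] [C mC <-]; rewrite setTI.
  apply: sub_sigma_algebra; exists (fun j => if j == i then C else setT).
    by move=> j; case: ifP.
  apply/seteqP; split => x /=; first by move=> Cx j _; case: eqP => // ->.
  by move=> /(_ i I); rewrite eqxx.
- apply: smallest_sub; first exact: sigma_algebra_measurable.
  move=> _ [B mB ->]; apply: fin_bigcap_measurable => // i _.
  by rewrite -[X in measurable X]setTI; exact: measurable_tnth.
Qed.

Hypotheses (ind : independent_family lambda) (idd : identically_distributed lambda).

(** Independence turns the box into a product, which is reindexed by [s]; identical distribution
    then removes [s] from each factor. *)
Lemma prob_box s (B : 'I_n.+1 -> set R[i]) : involutive s ->
  (forall i, measurable (B i)) ->
  P (coefs s @^-1` (\bigcap_(i in [set: 'I_n.+1]) [set x | B i (tnth x i)])) =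
  (\prod_(i in [set: 'I_n.+1]%SET) P (lambda i @^-1` B i))%E.
Proof.
move=> sK mB.
have -> : coefs s @^-1` (\bigcap_(i in [set: 'I_n.+1]) [set x | B i (tnth x i)])
   = \bigcap_(i in [set` [set: 'I_n.+1]%SET]) (lambda i @^-1` B (s i)).
  apply/seteqP; split => w /= h i _.
    by have := h (s i) I; rewrite /coefs /= tnth_mktuple sK.
  rewrite /= /coefs tnth_mktuple; have := h (s i); rewrite /= sK; apply.
  by rewrite /= finset.in_setT.
rewrite ind; last by move=> i _; exact: mB.
rewrite [RHS](reindex_inj (inv_inj sK))/=.
apply: eq_big => [i|i _]; first by rewrite !inE.
exact: idd.
Qed.

(** Both laws agree on boxes, which are stable under intersection and generate the product
    sigma-algebra; Dynkin's lemma concludes. *)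
Lemma exchangeable s A : involutive s -> measurable A ->
  P (coefs s @^-1` A) = P (coefs id @^-1` A).
Proof.
move=> sK mA; have mp := measurable_preimage_coefs.
apply: (@dynkin_induction _ E boxes
  (fun A => P (coefs s @^-1` A) = P (coefs id @^-1` A))).
- exact: measurable_boxes.
- move=> _ _ [B mB ->] [C mC ->]; exists (fun i => B i `&` C i).
    by move=> i; exact: measurableI.
  apply/seteqP; split => x /=; first by move=> [h1 h2] i _; split; [exact: h1|exact: h2].
  by move=> h; split => i _; have [] := h i I.
- by rewrite !preimage_setT.
- by move=> _ [B mB ->]; rewrite !prob_box.
- move=> S mS h; rewrite -!preimage_setC !probability_setC; try exact: mp.
  by rewrite h.
- move=> F mF tF h.
  have tp t : trivIset [set: nat] (fun i => coefs t @^-1` F i).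
    apply/trivIsetP => i j _ _ ij; rewrite -preimage_setI.
    by move/trivIsetP : tF => ->//; rewrite preimage_set0.
  rewrite !preimage_bigcup !measure_bigcup//;
    do ?[exact: tp | by move=> i _; exact: mp].
  by apply: eq_eseriesr => i _; exact: h.
- by rewrite -measurable_boxes.
Qed.

Lemma sum_prob_le (I : finType) (S : {set I}) (B : I -> set T) (N : nat) :
  (forall i, measurable (B i)) ->
  (forall w, (\sum_(i in S) (w \in B i) <= N)%N) ->
  (\sum_(i in S) P (B i) <= N%:R%:E)%E.
Proof.
move=> mB hN; pose F (w : T) : R := \sum_(i <- enum S) \1_(B i) w.
have mF : measurable_fun [set: T] F.
  by apply: measurable_sum => i; exact: measurable_indic.
have -> : (\sum_(i in S) P (B i) = \int[P]_w (F w)%:E)%E.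
  under eq_integral => w _ do rewrite /F -sumEFin.
  rewrite ge0_integral_sum//.
  - rewrite -big_enum; apply: eq_bigr => i _.
    by rewrite integral_indic// setIT.
  - by move=> i; apply/measurable_EFinP; exact: measurable_indic.
apply: (@le_trans _ _ (\int[P]_w (N%:R)%:E)%E).
  apply: ge0_le_integral => //.
  - by move=> w _; rewrite lee_fin; apply: sumr_ge0.
  - exact/measurable_EFinP.
  - move=> w _; rewrite lee_fin /F big_enum /=.
    apply: le_trans (_ : (\sum_(i in S) (w \in B i))%:R <= _); last by rewrite ler_nat.
    by rewrite natr_sum.
have PT : P [set: T] = 1%E by exact: probability_setT.
by rewrite integral_cst// [X in (_ * X)%E]PT mule1.
Qed.

(* By exchangeability [P A] is the average over [S] of the probabilities of the
   permuted events. *)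
Lemma prob_orbit (I : finType) (S : {set I}) (s : I -> 'I_n.+1 -> 'I_n.+1) A (m : nat) :
  (0 < #|S|)%N ->
  (forall i, i \in S -> involutive (s i)) -> measurable A ->
  (forall x : E,
    (m * #|[set i in S | [tuple tnth x (s i j) | j < n.+1] \in A]%SET| <= #|S|)%N) ->
  (m%:R%:E * P (coefs id @^-1` A) <= 1)%E.
Proof.
move=> S0 sK mA hx.
have [->|m0] := posnP m; first by rewrite mul0e.
have mB i : measurable (coefs (s i) @^-1` A) by exact: measurable_preimage_coefs.
have h : (\sum_(i in S) P (coefs (s i) @^-1` A) <= (#|S| %/ m)%:R%:E)%E.
  apply: sum_prob_le => // w; rewrite leq_divRL// mulnC.
  apply: leq_trans (hx (coefs id w)); rewrite leq_mul2l; apply/orP; right.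
  rewrite -sum1_card big_mkcond [leqRHS]big_mkcond /=; apply: leq_sum => i _.
  rewrite inE; case: (i \in S) => //=.
  have -> : [tuple tnth (coefs id w) (s i j) | j < n.+1] = coefs (s i) w.
    by apply: eq_mktuple => j; rewrite tnth_mktuple.
  rewrite (_ : (w \in _) = (coefs (s i) w \in A)); first by case: (_ \in A).
  by apply/idP/idP; rewrite !inE.
have fin : P (coefs id @^-1` A) \is a fin_num.
  by apply: fin_num_measure; exact: measurable_preimage_coefs.
move: h; rewrite (eq_bigr (fun=> P (coefs id @^-1` A))); last first.
  by move=> i iS; apply: exchangeable => //; exact: sK.
rewrite big_const -(fineK fin); set p := fine _.
have -> : iter #|S| (+%E p%:E) 0%E = (#|S|%:R * p)%:E.
  elim: #|_| => [|k IH]; first by rewrite mul0r.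
  by rewrite iterS IH -EFinD -nat1r mulrDl mul1r.
rewrite -!EFinM !lee_fin => h.
rewrite -(ler_pM2l (_ : 0 < #|S|%:R)) ?ltr0n// mulr1.
rewrite mulrCA (le_trans (ler_wpM2l _ h))// -natrM ler_nat.
by rewrite mulnC leq_trunc_div.
Qed.

End Exchangeability.

(** * Probabilities of records and of bad cells *)

Section Probabilities.
Context d (T : measurableType d) (R : realType) (P : probability T R) (n : nat).
Variable lambda : 'I_n.+1 -> {RV P >-> R[i]}.
Hypotheses (ind : independent_family lambda) (idd : identically_distributed lambda).
Local Notation E := (n.+1.-tuple R[i]).

Lemma le_inv_of_mul (m : nat) (B : set T) : measurable B -> (0 < m)%N ->
  (m%:R%:E * P B <= 1)%E -> (P B <= (m%:R^-1)%:E)%E.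
Proof.
move=> mB m0; have fin : P B \is a fin_num by exact: fin_num_measure.
rewrite -(fineK fin) -EFinM !lee_fin => h.
by rewrite -[leRHS]mul1r ler_pdivlMr ?ltr0n// mulrC.
Qed.

(** Among the transpositions of [nu] with an element of [nu |: D], at most one puts a strict maximum
    of the moduli at [nu]. *)
Lemma prob_record (nu : 'I_n.+1) (D : {set 'I_n.+1}) (A : set E) :
  nu \notin D -> measurable A ->
  A `<=` [set x | forall j, j \in D -> normc (tnth x j) < normc (tnth x nu)] ->
  (P (coefs lambda id @^-1` A) <= (#|D|.+1%:R^-1)%:E)%E.
Proof.
move=> nuD mA hA; apply: le_inv_of_mul => //.
  exact: measurable_preimage_coefs.
have cS : #|nu |: D|%SET = #|D|.+1 by rewrite cardsU1 nuD.
rewrite -cS.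
apply: (prob_orbit ind idd (S := (nu |: D)%SET) (s := fun j => tperm j nu)) => //.
- by rewrite cS.
- by move=> i _; exact: tpermK.
move=> x; rewrite -[leqRHS]muln1 leq_mul2l cS /=.
apply/card_le1_eqP => i j.
have key a b : [tuple tnth x (tperm a nu i) | i < n.+1] \in A ->
    a \in (nu |: D)%SET -> b \in (nu |: D)%SET -> b != a ->
    normc (tnth x b) < normc (tnth x a).
  move=> /set_mem/hA /= h aS; rewrite !inE => /orP[/eqP ->|bD] ba.
    have := h a; rewrite !tnth_mktuple tpermL tpermR; apply.
    by move: aS; rewrite !inE eq_sym (negbTE ba).
  have := h b bD; rewrite !tnth_mktuple tpermR tpermD//; first by rewrite eq_sym.
  by apply: contraNneq nuD => ->.
rewrite !finset.in_set => /andP[iS iA] /andP[jS jA]; apply/eqP/negPn/negP => ij.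
rewrite -finset.in_setU in iS; rewrite -finset.in_setU in jS.
have h1 := key i j iA iS jS.
have := lt_trans (h1 ij) (key j i jA jS iS _); rewrite ltxx eq_sym => /(_ ij).
by [].
Qed.

Lemma prob_left_record (nu : 'I_n.+1) :
  (P (coefs lambda id @^-1` [set x : E | left_record (tnth x) nu])
   <= (nu.+1%:R^-1)%:E)%E.
Proof.
have cD : #|[set j : 'I_n.+1 | (j < nu)%N]%SET| = nu.
  rewrite -sum1_card (eq_bigl (fun j : 'I_n.+1 => (j < nu)%N)).
    rewrite -(big_ord_widen n.+1 (fun=> 1%N)) ?sum1_card ?card_ord//.
    exact: ltnW.
  by move=> j; rewrite inE.
rewrite -[X in X.+1%:R]cD; apply: (prob_record (nu := nu)).
- by rewrite inE ltnn.
- exact: measurable_left_record.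
- by move=> x /= /forallP h j; rewrite inE => jnu; have := h j; rewrite jnu.
Qed.

Lemma prob_right_record (nu : 'I_n.+1) :
  (P (coefs lambda id @^-1` [set x : E | right_record (tnth x) nu])
   <= ((rev_ord nu).+1%:R^-1)%:E)%E.
Proof.
have cD : #|[set j : 'I_n.+1 | (nu < j)%N]%SET| = rev_ord nu.
  rewrite -sum1_card (reindex_inj rev_ord_inj)/=.
  rewrite (eq_bigl (fun j : 'I_n.+1 => (j < rev_ord nu)%N)).
    rewrite -(big_ord_widen n.+1 (fun=> 1%N)) ?sum1_card ?card_ord//.
    exact: ltnW.
  move=> j; rewrite inE /= !subSS; have := ltn_ord j; have := ltn_ord nu; lia.
rewrite -cD; apply: (prob_record (nu := nu)).
- by rewrite inE ltnn.
- exact: measurable_right_record.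
- by move=> x /= /forallP h j; rewrite inE => jnu; have := h j; rewrite jnu.
Qed.

Variables (L : R) (theta : R -> R).
Hypothesis L0 : 0 <= L.
Hypothesis thetaL : forall r1 r2 : R, 0 < r1 -> 0 < r2 ->
  `|theta r1 - theta r2| <= L * `|ln (r1 / r2)|.
Hypothesis n2 : (2 <= n)%N.

Lemma swap_free_pairs par nu k (F : {set 'I_n}) :
  F \subset free_pairs par nu k -> swap F nu = nu /\ swap F k = k.
Proof.
move=> /fintype.subsetP FV.
have fix_ (m : 'I_n.+1) :
    (forall j : 'I_n, j \in F -> (j : nat) != m /\ j.+1 != m :> nat) ->
    swap F m = m.
  move=> h; apply/val_inj => /=; rewrite val_swap ifN; last first.
    by apply/exists_inP => -[j /h[jm _]]; rewrite (negbTE jm).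
  rewrite ifN//; apply/andP => -[m0 /exists_inP[j /h[_ jm] /eqP jm1]].
  by move: jm; rewrite jm1 prednK// eqxx.
by split; apply: fix_ => j /FV; rewrite inE => /andP[_ /and4P[]].
Qed.

(** Swaps of free pairs preserve both the law and the centre of the cell, so the proportion bound of
    [card_degenerate_swaps] becomes a probability bound. *)
Lemma prob_bad_cell par nu k o :
  (P (coefs lambda id @^-1` [set x : E | bad_cell L theta par nu k o (tnth x)])
   <= ((2 ^ npairs n)%:R^-1)%:E)%E.
Proof.
have mA := measurable_bad_cell L0 thetaL par nu k o.
apply: le_inv_of_mul; first exact: measurable_preimage_coefs.
  by rewrite expn_gt0.
set V := free_pairs par nu k.
have Vpar j : j \in V -> odd j = par by rewrite inE => /andP[/eqP].
apply: (prob_orbit ind idd (S := powerset V) (s := fun F => swap F)) => //.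
- by rewrite card_powerset expn_gt0.
- by move=> F; rewrite inE => FV; apply: (swap_involutive Vpar).
move=> x; rewrite mulnC card_powerset.
have a0 := angle_gt0 L0 n2; have a1 := angle_small L0 n2.
have a2 : angle L n <= 1.
  by apply: le_trans a1; rewrite ler_peMl ?ler1n// ltW.
have sep := @angle_separated R L L0 n n2.
have eta0 : 0 < angle L n / 2 by rewrite divr_gt0.
have eta2 : angle L n / 2 <= 2 by lra.
have h := card_degenerate_swaps Vpar (tnth x) (center theta (tnth x) nu k o)
  eta0 eta2 (normc_expi _) sep (lexx (threshold L n)).
apply: leq_trans h; rewrite leq_mul2r; apply/orP; right.
apply/subset_leq_card/fintype.subsetP => F; rewrite !finset.in_set => /andP[FV].
move=> /set_mem /=; rewrite FV /= /bad_cell.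
have -> : tnth [tuple tnth x (swap F j) | j < n.+1] = tnth x \o swap F.
  by apply/funext => j; rewrite tnth_mktuple.
have [fnu fk] := swap_free_pairs FV.
by rewrite /center /crossing /= fnu fk.
Qed.

End Probabilities.

(** * The expected number of zeros *)

Section ZeroCount.
Variable R : realType.

Lemma mup_prod_XsubC (c : R[i]) (rs : seq R[i]) (z : R[i]) : c != 0 ->
  mup z (c *: \prod_(x <- rs) ('X - x%:P)) = count_mem z rs.
Proof.
move=> c0; rewrite -mul_polyC mupMr; last by rewrite rootC.
elim: rs => [|x rs IH].
  by rewrite big_nil mupNroot// rootE hornerC oner_eq0.
rewrite big_cons mupM ?IH ?polyXsubC_eq0//; last first.
  by rewrite monic_neq0// monic_prod_XsubC.
by rewrite -['X - x%:P]expr1 mup_XsubCX /=; case: eqP.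
Qed.

(** The sum is a supremum over finite subsets of [Gamma]; once the summations are exchanged, each
    entry of [rs] is counted at most once. *)
Lemma zeros_on_le_count (Gamma : set R[i]) (c : R[i]) (rs : seq R[i]) : c != 0 ->
  (zeros_on Gamma (c *: \prod_(x <- rs) ('X - x%:P)) <=
   ((count (fun z => z \in Gamma) rs)%:R : R)%:E)%E.
Proof.
move=> c0; have p0 : c *: \prod_(x <- rs) ('X - x%:P) != 0.
  by rewrite scaler_eq0 negb_or c0 monic_neq0// monic_prod_XsubC.
rewrite /zeros_on (negbTE p0); apply: ge_ereal_sup => _ [A [finA AG] <-].
rewrite fsbig_finite//= sumEFin lee_fin -natr_sum ler_nat.
under eq_bigr => z _ do rewrite mup_prod_XsubC// -sum1_count big_mkcond.
rewrite exchange_big/= -sum1_count [leqRHS]big_mkcond/=.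
apply: leq_sum => z _; rewrite -big_mkcond/=.
set s := finmap.enum_fset _.
have sA : (z \in s) = (z \in A) by exact: in_fset_set.
have us : uniq s by exact: finmap.fset_uniq.
rewrite sum1_count (eq_count (a2 := pred1 z)); last by move=> x; rewrite /= eq_sym.
rewrite count_uniq_mem// sA; case: (boolP (z \in A)) => // zA.
by rewrite (mem_set (AG _ (set_mem zA))).
Qed.

End ZeroCount.

Section Integral.
Import HBNNSimple.
Context d (T : measurableType d) (R : realType) (P : probability T R).

(* The integral of a nonnegative function is a supremum over simple functions
   below it, so [f] need not be measurable here. *)
Lemma integral_le_outside_null (f : T -> \bar R) (g : T -> R) (Z : set T) :
  (forall w, (0 <= f w)%E) -> measurable_fun [set: T] g -> (forall w, 0 <= g w) ->
  measurable Z -> P Z = 0%E -> (forall w, ~ Z w -> (f w <= (g w)%:E)%E) ->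
  (\int[P]_w f w <= \int[P]_w (g w)%:E)%E.
Proof.
move=> f0 mg g0 mZ Z0 fg; rewrite ge0_integralTE//.
apply: ge_ereal_sup => _ [h hf <-]; rewrite -integralT_nnsfun.
apply: ae_ge0_le_integral => //.
- by move=> w _; rewrite lee_fin; exact: fun_ge0.
- by apply/measurable_EFinP; exact: measurable_funPT.
- by move=> w _; rewrite lee_fin.
- exact/measurable_EFinP.
- exists Z; split => // w /= hw; apply: contrapT => Zw; apply: hw => _.
  by apply: le_trans (fg _ Zw); exact: hf.
Qed.

Lemma integral_sum_indic (I : finType) (B : I -> set T) :
  (forall i, measurable (B i)) ->
  (\int[P]_w (\sum_i \1_(B i) w)%:E = \sum_i P (B i))%E.
Proof.
move=> mB; under eq_integral => w _ do rewrite -sumEFin.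
rewrite ge0_integral_sum//.
- by apply: eq_bigr => i _; rewrite integral_indic// setIT.
- by move=> i; apply/measurable_EFinP; exact: measurable_indic.
Qed.

End Integral.

(** Each dyadic block contributes at most 1. *)
Lemma harmonic_le (R : realFieldType) (N j : nat) : (N <= 2 ^ j)%N ->
  \sum_(i < N) (i.+1%:R^-1 : R) <= j.+1%:R.
Proof.
move=> Nj; apply: (@le_trans _ _ (\sum_(0 <= i < 2 ^ j) (i.+1%:R^-1 : R))).
  rewrite -(big_mkord xpredT (fun i => i.+1%:R^-1 : R)).
  by rewrite [leRHS](@big_cat_nat _ _ _ N)//= lerDl sumr_ge0.
elim: j {N Nj} => [|j IH]; first by rewrite big_nat1 invr1.
rewrite (@big_cat_nat _ _ _ (2 ^ j))//=; last by rewrite leq_exp2l.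
rewrite -[leRHS]natr1 lerD//.
apply: (@le_trans _ _ (\sum_(2 ^ j <= i < 2 ^ j.+1) ((2 ^ j)%:R^-1 : R))).
  apply: ler_sum_nat => i /andP[ji _].
  by rewrite lef_pV2 ?posrE ?ltr0n ?expn_gt0// ler_nat leqW.
by rewrite sumr_const_nat expnS mul2n -addnn addnK -[leLHS]mulr_natr mulVf.
Qed.

Lemma log2n_le_ln (R : realType) (n : nat) : (2 <= n)%N ->
  (log2n n)%:R * ln 2 <= ln n%:R :> R.
Proof.
move=> n2; have n0 : (0 < n)%N by exact: ltnW.
rewrite mulrC mulr_natr -lnXn// ler_ln ?posrE ?exprn_gt0 ?ltr0n//.
by rewrite -natrX ler_nat; exact: trunc_logP.
Qed.

(** * Union bound and final estimate *)

Section Expectation.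
Context d (T : measurableType d) (R : realType) (P : probability T R) (n : nat).
Variable lambda : 'I_n.+1 -> {RV P >-> R[i]}.
Hypotheses (ind : independent_family lambda) (idd : identically_distributed lambda).
Hypothesis n2 : (2 <= n)%N.
Hypothesis lambda0 : P [set w | lambda ord0 w = 0] = 0%E.
Hypothesis lambdan : P [set w | lambda ord_max w = 0] = 0%E.
Variables (L : R) (theta : R -> R).
Hypothesis L0 : 0 <= L.
Hypothesis thetaL : forall r1 r2 : R, 0 < r1 -> 0 < r2 ->
  `|theta r1 - theta r2| <= L * `|ln (r1 / r2)|.
Variables (a M : nat).
Hypothesis ha : (mesh L)^-1 <= 2 ^+ a.
Hypothesis hM : (1 - mesh L) ^+ M <= mesh L / 8.

Let I := (M * log2n n)%N.
Let D := (4 * I.+1 * ((14 + 38 * (7 + a)) * log2n n ^ 2))%N.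
Let X := coefs lambda id.

Let cells := (bool * 'I_n.+1 * 'I_n.+1 * 'I_I.+1 * bool)%type.

Let bad_event (c : cells) : set T :=
  let: (par, nu, k, i, b) := c in
  X @^-1` [set x | bad_cell L theta par nu k (offset L i b) (tnth x)].

Let record_event (c : 'I_n.+1 * bool) : set T :=
  if c.2 then X @^-1` [set x | left_record (tnth x) c.1]
  else X @^-1` [set x | right_record (tnth x) c.1].

Let measurable_bad_event c : measurable (bad_event c).
Proof.
move: c => [[[[par nu] k] i] b]; apply: measurable_preimage_coefs.
exact: measurable_bad_cell.
Qed.

Let measurable_record_event c : measurable (record_event c).
Proof.
rewrite /record_event; case: ifP => _; apply: measurable_preimage_coefs.
  exact: measurable_left_record.
exact: measurable_right_record.
Qed.

(** If some cell is bad, the degree [n] bounds the number of zeros; otherwise each record accounts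
    for at most [D] of them. *)
Let majorant (w : T) : R :=
  n%:R * \sum_(c : cells) \1_(bad_event c) w +
  D%:R * \sum_(c : 'I_n.+1 * bool) \1_(record_event c) w.

Let tnth_X w : tnth (X w) = (fun k => lambda k w).
Proof. by apply/funext => k; rewrite tnth_mktuple. Qed.

Let zeros_le_majorant w : lambda ord0 w <> 0 -> lambda ord_max w <> 0 ->
  (zeros_on (polar_curve theta) (random_poly lambda w) <= (majorant w)%:E)%E.
Proof.
move=> /eqP x0 /eqP xn; set x := fun k => lambda k w in x0 xn *.
have -> : random_poly lambda w = coefpoly (fun k => lambda k w) by [].
set p := coefpoly _.
have pn : p`_n != 0 by rewrite -[n in p`_n]/(nat_of_ord (@ord_max n)) coef_coefpoly.
have p0 : p != 0 by apply: contraNneq pn => ->; rewrite coef0.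
have [rs prs] := closed_field_poly_normal p.
have lc0 : lead_coef p != 0 by rewrite lead_coef_eq0.
rewrite prs; apply: le_trans (zeros_on_le_count _ _ lc0) _.
rewrite lee_fin.
have indic_ge0 (J : finType) (B : J -> set T) : 0 <= \sum_c (\1_(B c) w : R).
  by apply: sumr_ge0.
have [/existsP[c bc]|/existsPn nb] := boolP [exists c, w \in bad_event c].
  apply: (@le_trans _ _ n%:R).
    rewrite ler_nat (leq_trans (count_size _ _))//.
    have : (size p <= n.+1)%N := size_coefpoly _.
    by rewrite prs size_scale// size_prod_XsubC.
  rewrite /majorant -[leLHS]addr0 lerD ?mulr_ge0//.
  rewrite ler_peMr// (bigD1 c)//= indicE bc lerDl; exact: sumr_ge0.
apply: (@le_trans _ _ (D%:R * \sum_(c : 'I_n.+1 * bool) \1_(record_event c) w));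
  last by rewrite lerDr mulr_ge0.
have nbad par nu k (i : 'I_I.+1) b : ~~ bad_cell L theta par nu k (offset L i b) x.
  apply/negP => hb; have /negP := nb (par, nu, k, i, b); apply; apply/mem_set.
  by rewrite /bad_event /= tnth_X.
have h := total_zeros L0 thetaL n2 ha hM x0 xn nbad prs.
apply: le_trans (_ : (\sum_(nu < n.+1)
  (left_record x nu || right_record x nu) * D)%:R <= _).
  by rewrite ler_nat.
rewrite -big_distrl natrM mulrC ler_wpM2l//.
rewrite -(pair_bigA _ (fun nu b => \1_(record_event (nu, b)) w : R))/= natr_sum.
apply: ler_sum => nu _; rewrite big_bool /= !indicE.
have -> : (w \in record_event (nu, true)) = left_record x nu.
  by apply/idP/idP => [/set_mem|h1]; [|apply/mem_set]; rewrite /record_event /= tnth_X.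
have -> : (w \in record_event (nu, false)) = right_record x nu.
  by apply/idP/idP => [/set_mem|h1]; [|apply/mem_set]; rewrite /record_event /= tnth_X.
by rewrite -natrD ler_nat; case: (left_record x nu); case: (right_record x nu).
Qed.

Let measurable_eq0 k : measurable [set w | lambda k w = 0].
Proof.
have [mre mim] := cmeasurable_comp (@measurable_funPT _ _ _ _ (lambda k)).
rewrite (_ : [set w | _] = ((@complex.Re R \o lambda k) @^-1` [set 0]) `&`
   ((@complex.Im R \o lambda k) @^-1` [set 0])).
  by apply: measurableI; rewrite -[_ @^-1` _]setTI; [exact: mre|exact: mim].
apply/seteqP; split => w /=; first by move=> ->.
by move=> [h1 h2]; apply/eqP; rewrite eq_complex h1 h2 !eqxx.
Qed.

(** Bad cells contribute at most [4 * I.+1] and records at most [D * (6 * l)]. With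
    [I.+1 <= M.+1 * l], this yields the constant [28 = 4 + 24]. *)
Lemma expected_zeros_le :
  (\int[P]_w zeros_on (polar_curve theta) (random_poly lambda w) <=
   ((28 * M.+1 * (14 + 38 * (7 + a)))%:R * (log2n n)%:R ^+ 4)%:E)%E.
Proof.
pose Z := [set w | lambda ord0 w = 0] `|` [set w | lambda ord_max w = 0].
have mZ : measurable Z by exact: measurableU.
have Z0 : P Z = 0%E.
  apply/eqP; rewrite eq_le measure_ge0 andbT.
  have : (P Z <= P [set w | lambda ord0 w = 0%R] + P [set w | lambda ord_max w = 0%R])%E.
    exact: measureU2.
  by rewrite lambda0 lambdan adde0.
have mmaj : measurable_fun [set: T] majorant.
  apply: measurable_funD; apply: measurable_funM; do ?exact: measurable_cst;
    by apply: measurable_sum => c; exact: measurable_indic.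
have maj0 w : 0 <= majorant w.
  by rewrite addr_ge0// mulr_ge0// sumr_ge0.
have zeros0 w : (0 <= zeros_on (polar_curve theta) (random_poly lambda w))%E.
  by rewrite /zeros_on; case: ifP => // _; apply: esum_ge0 => z _; rewrite lee_fin.
apply: (le_trans (integral_le_outside_null zeros0 mmaj maj0 mZ Z0 _)).
  by move=> w Zw; apply: zeros_le_majorant => h; apply: Zw; [left|right].
rewrite /majorant.
under eq_integral => w _ do rewrite EFinD 2!EFinM.
have msum (J : finType) (B : J -> set T) : (forall c, measurable (B c)) ->
    measurable_fun [set: T] (fun w => (\sum_c \1_(B c) w : R)%:E).
  by move=> mB; apply/measurable_EFinP/measurable_sum => c; exact: measurable_indic.
have sum0 (J : finType) (B : J -> set T) w : (0 <= (\sum_c \1_(B c) w : R)%:E)%E.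
  by rewrite lee_fin sumr_ge0.
rewrite ge0_integralD//; last 4 first.
- by move=> w _; rewrite mule_ge0// lee_fin.
- by apply: measurable_funeM; exact: msum.
- by move=> w _; rewrite mule_ge0// lee_fin.
- by apply: measurable_funeM; exact: msum.
rewrite !ge0_integralZl_EFin//; do ?exact: msum.
rewrite !integral_sum_indic//; set l := log2n n.
have l0 : (0 < l)%N := log2n_gt0 n2.
have hb : (\sum_c P (bad_event c) <=
    ((4 * (n.+1 * n.+1) * I.+1)%:R * (2 ^ npairs n)%:R^-1)%:E)%E.
  apply: (@le_trans _ _ (\sum_(c : cells) ((2 ^ npairs n)%:R^-1 : R)%:E)%E).
    apply: lee_sum => -[[[[par nu] k] i] b] _.
    exact: (prob_bad_cell ind idd L0 thetaL n2).
  rewrite sumEFin lee_fin sumr_const -[leLHS]mulr_natl ler_wpM2r//.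
  by rewrite ler_nat !card_prod !card_bool !card_ord; apply: eq_leq; clear; lia.
(* Left and right records each give a harmonic sum of at most [2 * l + 1]. *)
have hr : (\sum_c P (record_event c) <= (6 * l)%:R%:E)%E.
  rewrite -(pair_bigA _ (fun nu b => P (record_event (nu, b))))/=.
  apply: (@le_trans _ _ (\sum_(nu < n.+1)
      ((nu.+1%:R^-1 : R) + (rev_ord nu).+1%:R^-1)%:E)%E).
    apply: lee_sum => nu _; rewrite big_bool /= EFinD leeD//.
      exact: (prob_left_record ind idd).
    exact: (prob_right_record ind idd).
  rewrite sumEFin lee_fin big_split/= [X in _ + X](reindex_inj rev_ord_inj)/=.
  under [X in _ + X]eq_bigr => nu _ do rewrite subSS subKn -1?ltnS ?ltn_ord//.
  have h := @harmonic_le R n.+1 (2 * l) (leq_log2n n2).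
  apply: (le_trans (lerD h h)); rewrite -natrD ler_nat; lia.
apply: le_trans (leeD (_ : _ <= n%:R%:E * _)%E (_ : _ <= D%:R%:E * _)%E) _.
- by apply: lee_wpmul2l hb; rewrite lee_fin.
- by apply: lee_wpmul2l hr; rewrite lee_fin.
rewrite -!EFinM -EFinD lee_fin.
have hI : (I.+1 <= M.+1 * l)%N by rewrite /I -/l mulSn addnC -addn1 leq_add2l.
have cube : (n * (n.+1 * n.+1) <= 2 ^ npairs n)%N.
  have h := leq_log2n n2; rewrite -/l in h.
  apply: (@leq_trans (2 ^ (2 * l) * (2 ^ (2 * l) * 2 ^ (2 * l)))).
    by rewrite !leq_mul// ltnW.
  by rewrite -!expnD leq_exp2l// /npairs -/l; lia.
apply: (@le_trans _ _ ((4 * I.+1)%:R + (D * (6 * l))%:R)).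
  rewrite [X in _ <= _ + X]natrM lerD2r mulrA ler_pdivrMr ?ltr0n ?expn_gt0//.
  rewrite -!natrM ler_nat.
  have -> : (n * (4 * (n.+1 * n.+1) * I.+1) = 4 * I.+1 * (n * (n.+1 * n.+1)))%N.
    by clear; lia.
  by rewrite leq_mul2l cube orbT.
rewrite -natrX -natrD -natrM ler_nat /D -/l.
set A := (14 + _)%N.
have A1 : (1 <= A)%N by [].
have l4 : (l <= l ^ 4)%N by rewrite -[X in (X <= _)%N]expn1 leq_pexp2l.
have h1 : (4 * I.+1 <= 4 * (M.+1 * l ^ 4) * A)%N.
  apply: (@leq_trans (4 * (M.+1 * l))); first by rewrite leq_mul2l.
  by rewrite -[leqLHS]muln1 leq_mul// leq_mul2l leq_mul2l l4 !orbT.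
have h2 : (4 * I.+1 * (A * l ^ 2) * (6 * l) <= 24 * (M.+1 * l ^ 4) * A)%N.
  apply: (@leq_trans (4 * (M.+1 * l) * (A * l ^ 2) * (6 * l))).
    by rewrite !leq_mul2r leq_mul2l hI !orbT.
  apply: eq_leq; rewrite (_ : l ^ 4 = l * l ^ 2 * l)%N; first ring.
  by rewrite !expnS expn0; ring.
by apply: (leq_trans (leq_add h1 h2)); apply: eq_leq; ring.
Qed.

End Expectation.

Theorem corollary2 (R : realType) (L : R) (hL : 0 <= L) :
  exists C : R, 0 < C /\
    forall (d : measure_display) (T : measurableType d) (P : probability T R)
      (n : nat) (lambda : 'I_n.+1 -> {RV P >-> R[i]}),
      (2 <= n)%N ->
      independent_family lambda ->
      identically_distributed lambda ->
      P [set w | lambda ord0 w = 0] = 0%E ->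
      P [set w | lambda ord_max w = 0] = 0%E ->
      (ereal_sup [set \int[P]_w zeros_on Gamma (random_poly lambda w)
                 | Gamma in lipschitz_curve L]
       <= (C * ln n%:R ^+ 4)%:E)%E.
Proof.
have [a ha] := ex_mesh_exp L; have [M hM] := ex_mesh_steps hL.
have ln2_gt0 : 0 < ln 2 :> R by rewrite ln_gt0// ltr1n.
(* [a] and [M] come from [mesh L] alone, so the constant depends only on [L]; the power of [ln 2]
   converts binary logarithms to natural ones. *)
exists ((28 * M.+1 * (14 + 38 * (7 + a)))%:R / ln 2 ^+ 4); split.
  by rewrite divr_gt0 ?exprn_gt0// ltr0n.
move=> d T P n lambda n2 ind idd lambda0 lambdan.
apply: ge_ereal_sup => _ [Gamma [theta thetaL ->] <-].
apply: le_trans (expected_zeros_le ind idd n2 lambda0 lambdan hL thetaL ha hM) _.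
rewrite lee_fin -mulrA ler_wpM2l// mulrC ler_pdivlMr ?exprn_gt0// -exprMn.
apply: lerXn2r; last exact: log2n_le_ln.
  by rewrite nnegrE mulr_ge0// ltW.
by rewrite nnegrE ln_ge0// ler1n ltnW.
Qed.
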